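(* Let $M:\mathbb{R}^2\to\mathbf{vec}$ be a constructible bimodule with (horizontal) meta-diagram $\mathbf{mdgm}_M$. Define the multisets of rectangles $$\mathcal{R}:=\bigcup_{I\in\mathrm{Dgm}}\Big(\bigcup_{[a,b)\in\mathbf{mdgm}_M(I)} I\times[a,b)\Big),\qquad \mathcal{S}:=\bigcup_{I\in\mathrm{Dgm}}\Big(\bigcup_{-[a,b)\in\mathbf{mdgm}_M(I)} I\times[a,b)\Big),$$ where all unions are multiset unions. Then $(\mathcal{R},\mathcal{S})$ is a rank decomposition for $M$, i.e. $\mathrm{rank}_M=\mathrm{rank}_{\mathbf{k}_{\mathcal{R}}}-\mathrm{rank}_{\mathbf{k}_{\mathcal{S}}}$.
   Context: Fix a field $\mathbf{k}$; $\mathbf{vec}$ is the category of finite-dimensional $\mathbf{k}$-vector spaces. A persistence module over a poset $P$ is a functor $M:P\to\mathbf{vec}$, with internal maps $\varphi_M(p\le q)$; a bimodule is a persistence module over $\mathbb{R}^2$ with the product order. The rank invariant is $\mathrm{rank}_M(a,b):=\mathrm{rank}(\varphi_M(a\le b))$ for $a\le b$. For an interval $I$ of $P$, $\mathbf{k}^I$ is the interval module ($\mathbf{k}$ on $I$, $0$ elsewhere, identity maps within $I$, zero maps otherwise). Rank decomposition. For a multiset $\mathcal{R}$ of intervals of $\mathbb{R}^2$ let $\mathbf{k}_{\mathcal{R}}:=\bigoplus_{R\in\mathcal{R}}\mathbf{k}^R$. A pair $(\mathcal{R},\mathcal{S})$ of such multisets is a rank decomposition for $M$ if $\mathrm{rank}_M=\mathrm{rank}_{\mathbf{k}_{\mathcal{R}}}-\mathrm{rank}_{\mathbf{k}_{\mathcal{S}}}$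 as integer-valued functions on $\{(a,b):a\le b\in\mathbb{R}^2\}$. Constructibility. Let $S=\{s_1<\dots<s_n\}\subset\mathbb{R}$ be finite, and set $s_{n+1}:=\infty$ for this definition. $M:\mathbb{R}\to\mathbf{vec}$ is $S$-constructible if $M(a)=0$ for $a<s_1$ and $\varphi_M(a\le b)$ is an isomorphism whenever $s_i\le a\le b<s_{i+1}$, $1\le i\le n$. A bimodule $M$ is $S$-constructible if $M((x,y))=0$ whenever $x<s_1$ or $y<s_1$, and $\varphi_M((x_1,y_1)\le(x_2,y_2))$ is an isomorphism whenever $s_i\le x_1\le x_2<s_{i+1}$ and $s_j\le y_1\le y_2<s_{j+1}$, $1\le i,j\le n$. A module is constructible if it is $S$-constructible for some finite nonempty $S$. A constructible module over $\mathbb{R}$ is determined up to isomorphism by its barcode $\mathrm{barc}(M)$, the multiset of intervals $I$ (of the form $[b,d)$, $b\in\mathbb{R}$, $d\in\mathbb{R}\cup\{\infty\}$) with $M\cong\bigoplus_{I\in\mathrm{barc}(M)}\mathbf{k}^I$. $\mathbf{Pvec}$ is the set of isomorphism classes $[M]$ of such persistence modules over $\mathbb{R}$, a commutative monoid under $[M]\oplus[N]:=[M\oplus N]$; $\mathbf{SPvec}$ is its Grothendieck group, with elements written $[(M^+,M^-)]$ (representing $M^+-M^-$). Each $A\in\mathbf{SPvec}$ has a unique representative $(M^+,M^-)$ with $\mathrm{barc}(M^+)\cap\mathrm{barc}(M^-)=\emptyset$; one writes $[a,b)\in A$ (with multiplicity) for $[a,b)\in\mathrm{barc}(M^+)$ and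 $-[a,b)\in A$ (with multiplicity) for $[a,b)\in\mathrm{barc}(M^-)$, for this representative. Elements of $\mathbf{Pvec}$ are viewed in $\mathbf{SPvec}$ via $M\mapsto[(M,0)]$. $\mathrm{Dgm}$ is the poset, ordered by inclusion, of all intervals $[p,q)$ with $p<q$ in $\mathbb{R}$ and all $[p,\infty)$, $p\in\mathbb{R}$. For a bimodule $M$ and $s\in\mathbb{R}$, the vertical slice $M_x^s:\mathbb{R}\to\mathbf{vec}$ is $M_x^s(a)=M((s,a))$ with internal maps $\varphi_M((s,a)\le(s,b))$; for $s\le t$, $\phi_x(s\le t):M_x^s\to M_x^t$ is $\phi_x(s\le t)(a):=\varphi_M((s,a)\le(t,a))$. Meta-rank. For $S$-constructible $M$, $\mathbf{mrk}_M:\mathrm{Dgm}\to\mathbf{Pvec}$ is defined by: for $I=[s,s_i)$ with $s_i\in S$, $\mathbf{mrk}_M(I):=[\mathrm{im}(\phi_x(s\le s_i-\delta))]$ for some $\delta>0$ with $s_i-\delta\ge s$ and $s_i-\delta\ge s_{i-1}$; for $I=[s,\infty)$, $\mathbf{mrk}_M(I):=[\mathrm{im}(\phi_x(s\le\max(s,s_n)))]$; for all other $I=[s,t)$, $\mathbf{mrk}_M(I):=[\mathrm{im}(\phi_x(s\le t))]$. Meta-diagram. For $S$-constructible $M$, $\mathbf{mdgm}_M:\mathrm{Dgm}\to\mathbf{SPvec}$ is given, for $1\le i<j\le n$, by $$\mathbf{mdgm}_M([s_i,s_j)):=\mathbf{mrk}_M([s_i,s_j))-\mathbf{mrk}_M([s_i,s_{j+1}))+\mathbf{mrk}_M([s_{i-1},s_{j+1}))-\mathbf{mrk}_M([s_{i-1},s_j)),$$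 $$\mathbf{mdgm}_M([s_i,\infty)):=\mathbf{mrk}_M([s_i,\infty))-\mathbf{mrk}_M([s_{i-1},\infty))\quad(1\le i\le n),$$ where in these formulas (and in the definition of $\mathbf{mrk}$) $s_0$ is any value $<s_1$ and $s_{n+1}$ is any real value $>s_n$; for any other $[s,t)\in\mathrm{Dgm}$, $\mathbf{mdgm}_M([s,t)):=0$. *)

(* Defs.v *)
From HB Require Import structures.
From mathcomp Require Import all_boot all_order all_algebra generic_quotient.
From mathcomp Require Import finmap multiset.
From mathcomp Require Import boolp classical_sets fsbigop reals constructive_ereal.

Set Implicit Arguments.
Unset Strict Implicit.
Unset Printing Implicit Defensive.

Import Order.TTheory GRing.Theory Num.Theory.
Import VectorInternalTheory.

Local Open Scope classical_set_scope.
Local Open Scope ring_scope.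
Local Open Scope quotient_scope.

Section PersistenceModules.
Variables (k : fieldType) (d : Order.disp_t) (P : porderType d).

Record pmod := Pmod {
  pobj :> P -> vectType k;
  pmap : forall p q : P, (p <= q)%O -> 'Hom(pobj p, pobj q);
  pmap1 : forall (p : P) (h : (p <= p)%O), pmap h = \1%VF;
  pmapD : forall (p q r : P) (hpq : (p <= q)%O) (hqr : (q <= r)%O)
    (hpr : (p <= r)%O), pmap hpr = (pmap hqr \o pmap hpq)%VF }.

Definition rank_inv (M : pmod) (a b : P) (h : (a <= b)%O) : nat :=
  \dim (limg (pmap M h)).

Record pmor (M N : pmod) := Pmor {
  pfun :> forall p : P, 'Hom(M p, N p);
  pnat : forall (p q : P) (h : (p <= q)%O),
    (pfun q \o pmap M h = pmap N h \o pfun p)%VF }.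

Definition piso (M N : pmod) : Prop :=
  exists f : pmor M N, forall p, bijective (f p).

Lemma piso_refl M : piso M M.
Proof.
have H (p q : P) (h : (p <= q)%O) : (\1 \o pmap M h = pmap M h \o \1)%VF.
  by rewrite comp_lfun1l comp_lfun1r.
by exists (Pmor H) => p; exists id => x; rewrite /= id_lfunE.
Qed.

Lemma piso_sym M N : piso M N -> piso N M.
Proof.
case=> f bf; pose g p := (f p)^-1%VF.
have fK p : lker (f p) == 0%VS by apply/lker0P/bij_inj.
have gK p : cancel (g p) (f p).
  move=> y; rewrite /g; apply: limg_lfunVK; have [h _ hK] := bf p.
  by rewrite -(hK y) memv_img ?memvf.
have H (p q : P) (h : (p <= q)%O) : (g q \o pmap N h = pmap M h \o g p)%VF.
  apply/lfunP=> y; apply: (bij_inj (bf q)); rewrite !comp_lfunE gK.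
  by have /lfunP/(_ (g p y)) := pnat f h; rewrite !comp_lfunE gK.
exists (Pmor H) => p; exists (f p) => //; exact: lker0_lfunK.
Qed.

Lemma piso_trans N M Q : piso M N -> piso N Q -> piso M Q.
Proof.
case=> f bf [g bg].
have H (p q : P) (h : (p <= q)%O) :
    ((g q \o f q) \o pmap M h = pmap Q h \o (g p \o f p))%VF.
  by rewrite -comp_lfunA (pnat f) comp_lfunA (pnat g) comp_lfunA.
exists (Pmor H) => p; apply: (eq_bij (bij_comp (bg p) (bf p))) => x.
by rewrite /= comp_lfunE.
Qed.

Fact pmod0_1 (p : P) (h : (p <= p)%O) : (0 : 'Hom('rV[k]_0, 'rV[k]_0)) = \1%VF.
Proof. by apply/lfunP=> x; apply/rowP; case. Qed.

Definition pmod0 : pmod :=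
  @Pmod (fun=> 'rV[k]_0) (fun _ _ _ => 0) pmod0_1
    (fun _ _ _ _ _ _ => esym (comp_lfun0l _ _)).

Section DirectSum.
Variables M N : pmod.

Definition dsum_map (p q : P) (h : (p <= q)%O) :
    'Hom((M p * N p)%type, (M q * N q)%type) :=
  linfun (fun x => (pmap M h x.1, pmap N h x.2)).

Lemma dsum_mapE (p q : P) (h : (p <= q)%O) x :
  dsum_map h x = (pmap M h x.1, pmap N h x.2).
Proof.
have L : linear (fun x : (M p * N p)%type => (pmap M h x.1, pmap N h x.2)).
  by move=> a u v; congr pair; rewrite linearP.
pose f := GRing.isLinear.Build _ _ _ _ _ L.
pose F : {linear _ -> _} := HB.pack (fun x : (M p * N p)%type => (pmap M h x.1, pmap N h x.2)) f.
exact: (lfunE F).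
Qed.

Fact dsum_map1 (p : P) (h : (p <= p)%O) : dsum_map h = \1%VF.
Proof. by apply/lfunP=> -[x y]; rewrite dsum_mapE !pmap1 !id_lfunE. Qed.

Fact dsum_mapD (p q r : P) (hpq : (p <= q)%O) (hqr : (q <= r)%O)
  (hpr : (p <= r)%O) : dsum_map hpr = (dsum_map hqr \o dsum_map hpq)%VF.
Proof.
apply/lfunP=> -[x y]; rewrite comp_lfunE !dsum_mapE /=.
by rewrite !(pmapD _ hpq hqr) !comp_lfunE.
Qed.

Definition dsum : pmod :=
  @Pmod (fun p => (M p * N p)%type) dsum_map dsum_map1 dsum_mapD.

Lemma dsumE (p q : P) (h : (p <= q)%O) x :
  pmap dsum h x = (pmap M h x.1, pmap N h x.2).
Proof. exact: dsum_mapE. Qed.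

End DirectSum.

Lemma piso_build (M N : pmod) (f : forall p, {linear M p -> N p}) :
    (forall p, bijective (f p)) ->
    (forall p q (h : (p <= q)%O) x, f q (pmap M h x) = pmap N h (f p x)) ->
  piso M N.
Proof.
move=> bf nf.
have H (p q : P) (h : (p <= q)%O) :
    (linfun (f q) \o pmap M h = pmap N h \o linfun (f p))%VF.
  by apply/lfunP=> x; rewrite !comp_lfunE !lfunE nf.
by exists (Pmor H) => p; apply: (eq_bij (bf p)) => x; rewrite /= lfunE.
Qed.

Lemma dsum_iso M M' N N' : piso M M' -> piso N N' -> piso (dsum M N) (dsum M' N').
Proof.
move=> [f bf] [g bg].
have L p : linear (fun x : (M p * N p)%type => (f p x.1, g p x.2)).
  by move=> a u v; congr pair; rewrite linearP.
pose F p : {linear _ -> _} :=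
  HB.pack (fun x : (M p * N p)%type => (f p x.1, g p x.2))
    (GRing.isLinear.Build _ _ _ _ _ (L p)).
apply: (@piso_build (dsum M N) (dsum M' N') F) => [p|p q h [x y]] /=.
  have [f' fK f'K] := bf p; have [g' gK g'K] := bg p.
  by exists (fun x => (f' x.1, g' x.2)) => -[x y] /=; rewrite ?fK ?gK ?f'K ?g'K.
rewrite !dsum_mapE /=; congr pair.
  by have /lfunP/(_ x) := pnat f h; rewrite !comp_lfunE.
by have /lfunP/(_ y) := pnat g h; rewrite !comp_lfunE.
Qed.

Lemma dsumC_iso M N : piso (dsum M N) (dsum N M).
Proof.
have L p : linear (fun x : (M p * N p)%type => (x.2, x.1)) by [].
pose F p : {linear _ -> _} :=
  HB.pack (fun x : (M p * N p)%type => (x.2, x.1))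
    (GRing.isLinear.Build _ _ _ _ _ (L p)).
apply: (@piso_build (dsum M N) (dsum N M) F) => [p|p q h x].
  by exists (fun x => (x.2, x.1)) => -[].
by rewrite [F]lock !dsumE -lock /= ?dsumE.
Qed.

Lemma dsumA_iso M N Q : piso (dsum M (dsum N Q)) (dsum (dsum M N) Q).
Proof.
have L p : linear (fun x : (M p * (N p * Q p))%type => ((x.1, x.2.1), x.2.2)) by [].
pose F p : {linear _ -> _} :=
  HB.pack (fun x : (M p * (N p * Q p))%type => ((x.1, x.2.1), x.2.2))
    (GRing.isLinear.Build _ _ _ _ _ (L p)).
apply: (@piso_build (dsum M (dsum N Q)) (dsum (dsum M N) Q) F) => [p|p q h x].
  by exists (fun x => (x.1.1, (x.1.2, x.2))) => [[? []]|[[]]].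
by rewrite [F]lock !dsumE -lock /= ?dsumE.
Qed.

Lemma dsum0_iso M : piso (dsum pmod0 M) M.
Proof.
have L p : linear (fun x : ('rV[k]_0 * M p)%type => x.2) by [].
pose F p : {linear _ -> _} :=
  HB.pack (fun x : ('rV[k]_0 * M p)%type => x.2)
    (GRing.isLinear.Build _ _ _ _ _ (L p)).
apply: (@piso_build (dsum pmod0 M) M F) => [p|p q h x].
  by exists (fun x => (0, x)) => [[x y]|//]; congr pair; apply/rowP; case.
by rewrite [F]lock dsumE -lock.
Qed.

(* Persistence modules whose spaces are all of the form k^n. Unlike those of
   [pmod], they form a small type, which can carry a [choiceType] structure and
   be quotiented by isomorphism. *)
Record smod := Smod {
  sdim : P -> nat;
  smap : forall p q : P, (p <= q)%O -> 'Hom('rV[k]_(sdim p), 'rV[k]_(sdim q));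
  smap1 : forall (p : P) (h : (p <= p)%O), smap h = \1%VF;
  smapD : forall (p q r : P) (hpq : (p <= q)%O) (hqr : (q <= r)%O)
    (hpr : (p <= r)%O), smap hpr = (smap hqr \o smap hpq)%VF }.

Definition pmod_of (M : smod) : pmod :=
  @Pmod (fun p => 'rV[k]_(sdim M p)) (@smap M) (@smap1 M) (@smapD M).

Section Small.
Variable M : pmod.

Definition small_map (p q : P) (h : (p <= q)%O) :
    'Hom('rV[k]_(dim (M p)), 'rV[k]_(dim (M q))) :=
  linfun (v2r \o pmap M h \o r2v).

Fact small_map1 (p : P) (h : (p <= p)%O) : small_map h = \1%VF.
Proof. by apply/lfunP=> v; rewrite lfunE /= pmap1 !id_lfunE r2vK. Qed.

Fact small_mapD (p q r : P) (hpq : (p <= q)%O) (hqr : (q <= r)%O)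
  (hpr : (p <= r)%O) : small_map hpr = (small_map hqr \o small_map hpq)%VF.
Proof.
apply/lfunP=> v; rewrite comp_lfunE !lfunE /= v2rK.
by rewrite (pmapD _ hpq hqr) comp_lfunE.
Qed.

Definition small : smod := @Smod (fun p => dim (M p)) small_map small_map1 small_mapD.

Lemma small_iso : piso (pmod_of small) M.
Proof.
pose F p : {linear 'rV[k]_(dim (M p)) -> M p} := @r2v k (M p).
apply: (@piso_build (pmod_of small) M F) => [p|p q h x].
  by exists v2r; [exact: r2vK|exact: v2rK].
by rewrite /= lfunE /= v2rK.
Qed.

End Small.

Section Image.
Variables (M N : pmod) (f : pmor M N).

Let im p : vectType k := subvs_of (limg (f p)).

Definition pim_map (p q : P) (h : (p <= q)%O) : 'Hom(im p, im q) :=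
  linfun (fun v => vsproj (limg (f q)) (pmap N h (vsval v))).

Lemma pim_mapE (p q : P) (h : (p <= q)%O) v :
  vsval (pim_map h v) = pmap N h (vsval v).
Proof.
pose g := fun v : im p => vsproj (limg (f q)) (pmap N h (vsval v)).
have L : linear g by move=> a x y; rewrite /g !linearP.
pose G : {linear _ -> _} := HB.pack g (GRing.isLinear.Build _ _ _ _ _ L).
rewrite (lfunE G) /= /g vsprojK //.
have /memv_imgP[x _ ->] := subvsP v.
have /lfunP/(_ x) := pnat f h; rewrite !comp_lfunE => <-.
by rewrite memv_img ?memvf.
Qed.

Fact pim_map1 (p : P) (h : (p <= p)%O) : pim_map h = \1%VF.
Proof. by apply/lfunP=> x; apply/val_inj; rewrite /= pim_mapE pmap1 !id_lfunE. Qed.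

Fact pim_mapD (p q r : P) (hpq : (p <= q)%O) (hqr : (q <= r)%O)
  (hpr : (p <= r)%O) : pim_map hpr = (pim_map hqr \o pim_map hpq)%VF.
Proof.
apply/lfunP=> x; apply/val_inj.
by rewrite /= comp_lfunE !pim_mapE (pmapD _ hpq hqr) comp_lfunE.
Qed.

Definition pim : pmod := @Pmod im pim_map pim_map1 pim_mapD.

Lemma pimE (p q : P) (h : (p <= q)%O) (v : pim p) :
  vsval (pmap pim h v) = pmap N h (vsval v).
Proof. exact: pim_mapE. Qed.

End Image.

Definition is_pinterval (I : set P) : Prop :=
  [/\ I !=set0,
      forall p q r, I p -> I r -> (p <= q)%O -> (q <= r)%O -> I q
    & forall p q, I p -> I q -> exists s : seq P,
        [/\ path (>=<%O) p s, last p s = q & forall x, x \in s -> I x]].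

Record pintv := Pintv { pset :> set P; psetP : `[< is_pinterval pset >] }.

HB.instance Definition _ := [isSub for pset].
HB.instance Definition _ := [Choice of pintv by <:].

(* The boolean p \in I is used as a dimension: 'rV[k]_(p \in I) is the line k
   inside I and 0 outside, and right multiplication by the all-ones matrix of
   size (p \in I) x (q \in I) is the identity of k if p and q lie in I, and 0
   otherwise. *)
Definition kint_map (I : pintv) (p q : P) (_ : (p <= q)%O) :
    'Hom('rV[k]_(p \in pset I), 'rV[k]_(q \in pset I)) :=
  linfun (mulmxr (const_mx 1)).

Fact kint_map1 (I : pintv) (p : P) (h : (p <= p)%O) : kint_map I h = \1%VF.
Proof.
apply/lfunP=> v; rewrite lfunE /= id_lfunE -[RHS]mulmx1; congr mulmx.
apply/matrixP=> i j; rewrite !mxE; move: (i) (j); case: (p \in _) => [|[]//] i' j'.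
by rewrite !ord1.
Qed.

Fact kint_mapD (I : pintv) (p q r : P) (hpq : (p <= q)%O) (hqr : (q <= r)%O)
  (hpr : (p <= r)%O) : kint_map I hpr = (kint_map I hqr \o kint_map I hpq)%VF.
Proof.
apply/lfunP=> v; rewrite comp_lfunE !lfunE /= -mulmxA; congr mulmx.
apply/matrixP=> i j; rewrite !mxE.
under eq_bigr do rewrite !mxE mulr1.
rewrite sumr_const card_ord.
suff -> : q \in pset I by [].
have [_ cvx _] : is_pinterval I by apply/asboolP/psetP.
have pI : p \in pset I by case: (p \in _) i => // -[].
have rI : r \in pset I by case: (r \in _) j => // -[].
by rewrite inE; apply: (cvx p q r) => //; exact/set_mem.
Qed.

Definition kint (I : pintv) : pmod :=
  @Pmod (fun p => 'rV[k]_(p \in pset I)) (@kint_map I) (@kint_map1 I)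
    (@kint_mapD I).

Definition kints (s : seq pintv) : pmod := foldr (fun I => dsum (kint I)) pmod0 s.

Local Open Scope mset_scope.

(* The multisets are finite, so that kints RR and kints SS are direct sums with
   values in finite-dimensional spaces. *)
Definition rank_decomposition (M : pmod) (RR SS : {mset pintv}) : Prop :=
  forall (a b : P) (h : (a <= b)%O),
    (rank_inv M h)%:Z = (rank_inv (kints RR) h)%:Z - (rank_inv (kints SS) h)%:Z.

End PersistenceModules.

Arguments kint_map {k d P} I {p q}.
Arguments kint {k d P} I.
Arguments kints {k d P} s.
Arguments pmod0 {k d P}.

(* The Grothendieck group of a commutative monoid. *)
Section Grothendieck.
Variable N : nmodType.

Definition groth_rel : rel (N * N) :=
  fun x y => `[< exists e : N, x.1 + y.2 + e = y.1 + x.2 + e >].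

Fact groth_rel_refl : reflexive groth_rel.
Proof. by move=> x; apply/asboolP; exists 0. Qed.

Fact groth_rel_sym : symmetric groth_rel.
Proof. by move=> x y; apply/asboolP/asboolP=> -[e he]; exists e. Qed.

Fact groth_rel_trans : transitive groth_rel.
Proof.
move=> y x z /asboolP[e he] /asboolP[f hf]; apply/asboolP.
exists (y.1 + y.2 + e + f).
rewrite [LHS](AC (2*4) ((1*4*5)*(3*2*6))) /= he hf.
by rewrite [LHS](AC (3*3) ((4*2)*(1*5*3*6))).
Qed.

Canonical groth_equiv := EquivRel groth_rel groth_rel_refl groth_rel_sym groth_rel_trans.

Definition groth := {eq_quot groth_rel}.

HB.instance Definition _ := Choice.on groth.
HB.instance Definition _ := EqQuotient.on groth.

Lemma groth_eqP (x y : N * N) :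
  reflect (exists e, x.1 + y.2 + e = y.1 + x.2 + e) (\pi_groth x == \pi_groth y).
Proof. by rewrite piE; exact: asboolP. Qed.

Definition groth_add := lift_op2 groth (fun x y : N * N => (x.1 + y.1, x.2 + y.2)).
Definition groth_opp := lift_op1 groth (fun x : N * N => (x.2, x.1)).

Fact pi_groth_add :
  {morph \pi_groth : x y / (x.1 + y.1, x.2 + y.2) >-> groth_add x y}.
Proof.
move=> x y; unlock groth_add; apply/eqP/groth_eqP => /=.
have /eqP/groth_eqP[e he] := esym (reprK (\pi_groth x)).
have /eqP/groth_eqP[f hf] := esym (reprK (\pi_groth y)).
exists (e + f).
rewrite [LHS](AC (2*2*2) ((1*3*5)*(2*4*6))) /= he hf.
by rewrite [LHS](AC (3*3) ((1*4)*(2*5)*(3*6))).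
Qed.
Canonical pi_groth_add_morph := PiMorph2 pi_groth_add.

Fact pi_groth_opp : {morph \pi_groth : x / (x.2, x.1) >-> groth_opp x}.
Proof.
move=> x; unlock groth_opp; apply/eqP/groth_eqP => /=.
have /eqP/groth_eqP[e he] := reprK (\pi_groth x).
by exists e; rewrite (addrC x.2) he (addrC x.1).
Qed.
Canonical pi_groth_opp_morph := PiMorph1 pi_groth_opp.

Fact groth_addA : associative groth_add.
Proof.
by move=> x y z; rewrite -[x]reprK -[y]reprK -[z]reprK !piE /= !addrA.
Qed.

Fact groth_addC : commutative groth_add.
Proof.
by move=> x y; rewrite -[x]reprK -[y]reprK !piE /=; congr \pi; congr pair; rewrite addrC.
Qed.

Fact groth_add0 : left_id (\pi_groth (0, 0)) groth_add.
Proof. by move=> x; rewrite -[x]reprK !piE /= !add0r -surjective_pairing. Qed.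

Fact groth_addN : left_inverse (\pi_groth (0, 0)) groth_opp groth_add.
Proof.
move=> x; rewrite -[x]reprK !piE /=; apply/eqP/groth_eqP => /=.
by exists 0; rewrite !addr0 add0r addrC.
Qed.

HB.instance Definition _ :=
  GRing.isZmodule.Build groth groth_addA groth_addC groth_add0 groth_addN.

Definition to_groth (x : N) : groth := \pi_groth (x, 0).

End Grothendieck.

Section Constructible.
Variables (k : fieldType) (R : realType).

Definition grid (S : seq R) : bool := sorted <%R S && (S != [::]).

(* [in_cell S i a] says s_(i+1) <= a < s_(i+2), for S = {s_1 < ... < s_n} and
   with s_(n+1) = +oo. *)
Definition in_cell (S : seq R) (i : nat) (a : R) : bool :=
  (nth 0 S i <= a) && (a%:E < nth +oo (map EFin S) i.+1)%E.

Definition S_constructible1 (S : seq R) (M : pmod k R) : Prop :=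
  [/\ grid S,
      forall a, a < nth 0 S 0 -> \dim {:M a} = 0%N
    & forall i (a b : R) (h : a <= b), (i < size S)%N ->
        in_cell S i a -> in_cell S i b -> bijective (pmap M h)].

Definition S_constructible2 (S : seq R) (M : pmod k (R *p R)) : Prop :=
  [/\ grid S,
      forall z, (z.1 < nth 0 S 0) || (z.2 < nth 0 S 0) -> \dim {:M z} = 0%N
    & forall i j (z w : R *p R) (h : (z <= w)%O), (i < size S)%N -> (j < size S)%N ->
        in_cell S i z.1 -> in_cell S i w.1 ->
        in_cell S j z.2 -> in_cell S j w.2 -> bijective (pmap M h)].

Definition constructible1 (M : pmod k R) : Prop := exists S, S_constructible1 S M.

Lemma sorted_nth_le (S : seq R) i j :
  sorted <%R S -> (i <= j)%N -> (j < size S)%N -> nth 0 S i <= nth 0 S j.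
Proof.
move=> sS ij jS; rewrite lt_sorted_uniq_le in sS; case/andP: sS => _ sS.
by apply: (sorted_leq_nth le_trans le_refl) => //; rewrite inE // (leq_ltn_trans ij).
Qed.

Lemma in_cell_le (S : seq R) i a s : sorted <%R S -> (i < size S)%N ->
  in_cell S i a -> s \in S -> (s <= a) = (index s S <= i)%N.
Proof.
move=> sS iS /andP[la ga] sSs; have idx : (index s S < size S)%N by rewrite index_mem.
have sE : nth 0 S (index s S) = s by rewrite nth_index.
case: leqP => ij.
  by rewrite -sE (le_trans _ la) // sorted_nth_le.
apply/negbTE; rewrite -ltNge -sE.
move: ga; rewrite (nth_map 0) ?(leq_ltn_trans ij) // lte_fin => /lt_le_trans; apply.
exact: sorted_nth_le.
Qed.

Lemma in_cell_dec (S : seq R) (a : R) : grid S ->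
  a < nth 0 S 0 \/
  exists2 i, (i < size S)%N & forall b, (forall s, s \in S -> (s <= a) = (s <= b)) ->
    in_cell S i b.
Proof.
case/andP=> sS S0; have [|le0] := ltP a (nth 0 S 0); [by left|right].
pose p s := a < s.
have hp : (0 < find p S)%N.
  by rewrite /p; case: (S) S0 le0 => [|s S'] //= _ le0; rewrite ltNge le0.
have pS : ((find p S).-1 < size S)%N by rewrite prednK // find_size.
exists (find p S).-1 => // b ab; apply/andP; split.
  rewrite -ab ?mem_nth // leNgt; apply/negP => h.
  have lt : ((find p S).-1 < find p S)%N by rewrite prednK.
  by have := before_find 0 lt; rewrite /p h.
rewrite prednK //; have [fS|fS] := ltnP (find p S) (size S); last first.
  by rewrite nth_default ?size_map // ltry.
rewrite (nth_map 0) // lte_fin ltNge -ab ?mem_nth // -ltNge.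
by apply: (nth_find 0); rewrite has_find.
Qed.

Lemma bij_dim0 (V W : vectType k) (f : 'Hom(V, W)) :
  \dim {:V} = 0%N -> \dim {:W} = 0%N -> bijective f.
Proof.
have z (U : vectType k) : \dim {:U} = 0%N -> forall x : U, x = 0.
  by move/eqP; rewrite dimv_eq0 => /eqP U0 x; apply/eqP; rewrite -memv0 -U0 memvf.
move=> /z V0 /z W0; exists (fun=> 0) => x; last by rewrite linear0 [x]W0.
by rewrite [x]V0.
Qed.

Lemma S_constructible1_sub (S T : seq R) M :
  S_constructible1 S M -> grid T -> {subset S <= T} -> S_constructible1 T M.
Proof.
move=> [gS M0 Mb] gT ST; have [sS S0] := andP gS; have [sT T0] := andP gT.
have s0 : nth 0 S 0 \in T by apply/ST/mem_nth; rewrite lt0n size_eq0.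
split=> // [a aT|i a b h iT ca cb].
  apply: M0; apply: (lt_le_trans aT).
  rewrite -[leRHS](nth_index 0 s0); apply: sorted_nth_le => //.
  by rewrite index_mem.
have ab s : s \in S -> (s <= a) = (s <= b).
  by move=> /ST sTs; rewrite !(in_cell_le sT iT _ sTs).
have [a0|[j jS cj]] := in_cell_dec a gS.
  have b0 : b < nth 0 S 0.
    by rewrite ltNge -ab ?mem_nth ?lt0n ?size_eq0 // -ltNge.
  by apply: bij_dim0; apply: M0.
by apply: (Mb j) => //; apply: cj.
Qed.

Lemma constructible_dsum (M N : pmod k R) :
  constructible1 M -> constructible1 N -> constructible1 (dsum M N).
Proof.
move=> [S cS] [T cT]; pose U := sort <=%R (undup (S ++ T)).
have memU s : (s \in U) = (s \in S) || (s \in T).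
  by rewrite mem_sort mem_undup mem_cat.
have gU : grid U.
  rewrite /grid sort_lt_sorted undup_uniq /=.
  have [/andP[_ S0] _ _] := cS.
  have : nth 0 S 0 \in U by rewrite memU mem_nth // lt0n size_eq0.
  by apply: contraTneq => ->.
have [_ M0 Mb] : S_constructible1 U M.
  by apply: (S_constructible1_sub cS) => // s; rewrite memU => ->.
have [_ N0 Nb] : S_constructible1 U N.
  by apply: (S_constructible1_sub cT) => // s; rewrite memU orbC => ->.
exists U; split=> // [a aU|i a b h iU ca cb].
  by rewrite dimvf /dim /= -!dimvf; have := M0 a aU; have := N0 a aU; rewrite !dimvf /dim => -> ->.
have [f fK Kf] := Mb i a b h iU ca cb; have [g gK Kg] := Nb i a b h iU ca cb.
exists (fun x => (f x.1, g x.2)) => -[x y] /=.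
  by rewrite dsumE /= fK gK.
by rewrite dsumE /= Kf Kg.
Qed.

Lemma constructible_pmod0 : constructible1 (pmod0 : pmod k R).
Proof.
exists [:: 0]; split=> // [a _|i a b h _ _ _]; rewrite ?dimvf //.
by apply: bij_dim0; rewrite dimvf.
Qed.

Lemma constructible_iso (M N : pmod k R) :
  piso M N -> constructible1 M -> constructible1 N.
Proof.
case=> f bf [S [gS M0 Mb]]; exists S; split=> // [a aS|i a b h iS ca cb].
  have [g _ gK] := bf a; apply/eqP; rewrite dimv_eq0 -subv0.
  apply/subvP=> y _; rewrite memv0 -[y]gK.
  have : g y \in {: M a}%VS by exact: memvf.
  by move/eqP: (M0 a aS); rewrite dimv_eq0 => /eqP ->; rewrite memv0 => /eqP ->; rewrite linear0.
have [g gK Kg] := bf a.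
apply: (@eq_bij _ _ (f b \o pmap M h \o g)).
  apply: bij_comp; first by apply: bij_comp; [exact: bf|exact: (Mb i)].
  by exists (f a).
by move=> x /=; have /lfunP/(_ (g x)) := pnat f h; rewrite !comp_lfunE Kg.
Qed.

Record cmod := Cmod { cval : smod k R; cvalP : constructible1 (pmod_of cval) }.

HB.instance Definition _ := gen_eqMixin cmod.
HB.instance Definition _ := gen_choiceMixin cmod.

Definition ciso : rel cmod := fun M N => `[< piso (pmod_of (cval M)) (pmod_of (cval N)) >].

Fact ciso_refl : reflexive ciso.
Proof. by move=> M; apply/asboolP/piso_refl. Qed.

Fact ciso_sym : symmetric ciso.
Proof. by move=> M N; apply/asboolP/asboolP => /piso_sym. Qed.

Fact ciso_trans : transitive ciso.
Proof. by move=> N M Q /asboolP h /asboolP g; apply/asboolP/(piso_trans h g). Qed.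

Canonical ciso_equiv := EquivRel ciso ciso_refl ciso_sym ciso_trans.

Definition Pvec := {eq_quot ciso}.

HB.instance Definition _ := Choice.on Pvec.
HB.instance Definition _ := EqQuotient.on Pvec.

Definition csmall (M : pmod k R) (cM : constructible1 M) : cmod :=
  Cmod (constructible_iso (piso_sym (small_iso M)) cM).

(* The isomorphism class [M]. *)
Definition iclass (M : pmod k R) (cM : constructible1 M) : Pvec := \pi_Pvec (csmall cM).

Lemma iclass_eqP (M N : pmod k R) (cM : constructible1 M) (cN : constructible1 N) :
  iclass cM = iclass cN <-> piso M N.
Proof.
split=> [/eqP|h].
  rewrite piE => /asboolP /= h; apply: piso_trans (small_iso N).
  by apply: piso_trans h; exact/piso_sym/small_iso.
apply/eqP; rewrite piE; apply/asboolP => /=.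
apply: piso_trans (small_iso M) _; apply: piso_trans h _.
exact/piso_sym/small_iso.
Qed.

Lemma iclass_repr (x : Pvec) : iclass (cvalP (repr x)) = x.
Proof. by rewrite -[RHS]reprK; apply/eqP; rewrite piE; apply/asboolP/small_iso. Qed.

Definition Pvec0 : Pvec := iclass constructible_pmod0.

Definition Pvec_add (x y : Pvec) : Pvec :=
  iclass (constructible_dsum (cvalP (repr x)) (cvalP (repr y))).

Lemma iclass_dsum (M N : pmod k R) (cM : constructible1 M) (cN : constructible1 N) :
  Pvec_add (iclass cM) (iclass cN) = iclass (constructible_dsum cM cN).
Proof.
by apply/iclass_eqP/dsum_iso; apply/(iclass_eqP (cvalP _) _)/iclass_repr.
Qed.

Fact Pvec_addA : associative Pvec_add.
Proof.
move=> x y z; rewrite -[x]iclass_repr -[y]iclass_repr -[z]iclass_repr !iclass_dsum.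
exact/iclass_eqP/dsumA_iso.
Qed.

Fact Pvec_addC : commutative Pvec_add.
Proof. by move=> x y; apply/iclass_eqP/dsumC_iso. Qed.

Fact Pvec_add0 : left_id Pvec0 Pvec_add.
Proof.
by move=> x; rewrite -[x]iclass_repr iclass_dsum; apply/iclass_eqP/dsum0_iso.
Qed.

HB.instance Definition _ := GRing.isNmodule.Build Pvec Pvec_addA Pvec_addC Pvec_add0.

Definition SPvec : zmodType := groth Pvec.

(* The elements of Dgm, which are also the possible bars of a constructible
   module over R: half-open intervals [p, q) with p real and q <= +oo. *)
Record bar := Bar { bends :> R * \bar R; barP : (bends.1%:E < bends.2)%E }.

HB.instance Definition _ := [isSub for bends].
HB.instance Definition _ := [Choice of bar by <:].

Definition bleft (I : bar) : R := I.1.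
Definition bright (I : bar) : \bar R := I.2.

Definition bset (I : bar) : set R := [set x | bleft I <= x /\ (x%:E < bright I)%E].

Lemma bset_convex I (x y z : R) : bset I x -> bset I z -> x <= y -> y <= z -> bset I y.
Proof.
by move=> [lx _] [_ zr] xy yz; split; [apply: le_trans xy|apply: le_lt_trans zr; rewrite lee_fin].
Qed.

Lemma bset_min I (x y : R) : bset I x -> bset I y -> bset I (Num.min x y).
Proof. by move=> Ix Iy; case: leP. Qed.

Lemma bset_left I : bset I (bleft I).
Proof. by split=> //; exact: barP. Qed.

Fact bar_is_pinterval I : `[< is_pinterval (bset I) >].
Proof.
apply/asboolP; split; first by exists (bleft I); exact: bset_left.
  exact: bset_convex.
move=> x y Ix Iy; exists [:: y]; split=> //=; first by rewrite real_comparable ?num_real.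
by move=> z; rewrite inE => /eqP ->.
Qed.

Definition bar_itv (I : bar) : pintv R := Pintv (bar_is_pinterval I).

Fact rect_is_pinterval (I J : bar) :
  `[< @is_pinterval _ (R *p R) [set z | bset I z.1 /\ bset J z.2] >].
Proof.
apply/asboolP; split.
- by exists (bleft I, bleft J); split; exact: bset_left.
- move=> p q r [Ip Jp] [Ir Jr]; rewrite !leEprod => /andP[pq1 pq2] /andP[qr1 qr2].
  by split; [apply: (bset_convex Ip Ir)|apply: (bset_convex Jp Jr)].
move=> p q [Ip Jp] [Iq Jq]; pose m : R *p R := (Num.min p.1 q.1, Num.min p.2 q.2).
exists [:: m; q]; split=> //.
  rewrite /= /Order.comparable !leEprod /= !ge_min !lexx ?orbT /=.
  by rewrite ?orbT.
move=> z; rewrite !inE => /orP[/eqP ->|/eqP -> //].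
by split; exact: bset_min.
Qed.

Definition rect (I J : bar) : pintv (R *p R) := Pintv (rect_is_pinterval I J).

Local Open Scope mset_scope.

Definition is_barcode (M : pmod k R) (B : {mset bar}) : Prop :=
  piso M (kints (map bar_itv B)).

(* The barcodes of M^+ and M^- for the representative (M^+, M^-) of A whose
   barcodes are disjoint; this pair exists and is unique, so the default value
   of [xget] is irrelevant. *)
Definition signed_barcode (A : SPvec) : {mset bar} * {mset bar} :=
  xget (mset0, mset0) [set B |
    exists (Mp Mn : pmod k R) (cp : constructible1 Mp) (cn : constructible1 Mn),
    [/\ A = \pi_(groth Pvec) (iclass cp, iclass cn),
        is_barcode Mp B.1, is_barcode Mn B.2 & B.1 `&` B.2 = mset0]].

Definition pos_bars (A : SPvec) : {mset bar} := (signed_barcode A).1.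
Definition neg_bars (A : SPvec) : {mset bar} := (signed_barcode A).2.

Section Slices.
Variable M : pmod k (R *p R).

Fact slice_le (s : R) (a b : R) : a <= b -> ((s, a) <= (s, b) :> (R *p R))%O.
Proof. by rewrite leEprod /= lexx. Qed.

Fact shift_le (a : R) (s t : R) : s <= t -> ((s, a) <= (t, a) :> (R *p R))%O.
Proof. by rewrite leEprod /= lexx andbT. Qed.

Definition vslice (s : R) : pmod k R :=
  @Pmod k _ R (fun a => M (s, a)) (fun a b h => pmap M (slice_le s h))
    (fun a h => pmap1 M (slice_le s h))
    (fun a b c hab hbc hac => pmapD M (slice_le s hab) (slice_le s hbc) (slice_le s hac)).

Fact phix_nat (s t : R) (h : s <= t) (a b : R) (hab : a <= b) :
  (pmap M (shift_le b h) \o pmap (vslice s) hab =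
   pmap (vslice t) hab \o pmap M (shift_le a h))%VF.
Proof.
have hd : ((s, a) <= (t, b) :> (R *p R))%O by rewrite leEprod /= h.
by rewrite -(pmapD M _ _ hd) -(pmapD M _ _ hd).
Qed.

Definition phix (s t : R) (h : s <= t) : pmor (vslice s) (vslice t) :=
  @Pmor k _ R (vslice s) (vslice t) (fun a => pmap M (shift_le a h))
    (fun a b hab => phix_nat h hab).

End Slices.

Section MetaDiagram.
Variables (S : seq R).

(* The points s_0, s_1, ..., s_n, s_(n+1), given s_0 and s_(n+1). *)
Definition gpts (s0 sN : R) (i : nat) : R := nth 0 (s0 :: rcons S sN) i.

(* The auxiliary choices in the definitions of the meta-rank and of the
   meta-diagram: s_0, s_(n+1), and a delta for each I = [s, s_i). *)
Record choices := Choices {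
  cfirst : R;
  clast : R;
  delta : bar -> R;
  cfirst_lt : cfirst < nth 0 S 0;
  clast_gt : last 0 S < clast;
  deltaP : forall (I : bar) (i : nat), (1 <= i <= size S)%N ->
    bright I = (gpts cfirst clast i)%:E ->
    [/\ 0 < delta I, bleft I <= gpts cfirst clast i - delta I
      & gpts cfirst clast i.-1 <= gpts cfirst clast i - delta I] }.

Variable c : choices.

Let s := gpts (cfirst c) (clast c).

Definition mrk_end (I : bar) : R :=
  match bright I with
  | t%:E => if t \in S then t - delta c I else t
  | +oo%E => Num.max (bleft I) (s (size S))
  | -oo%E => bleft I
  end.

Fact mrk_end_ge (I : bar) : bleft I <= mrk_end I.
Proof.
rewrite /mrk_end; have := barP I; rewrite -/(bleft I) -/(bright I).
case E: (bright I) => [t||] //=; last by rewrite le_max lexx.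
rewrite lte_fin => /ltW; case: ifP => // tS _.
have sE : t = s (index t S).+1.
  by rewrite /s /gpts /= nth_rcons index_mem tS nth_index.
have [||_ + _] := @deltaP c I (index t S).+1; rewrite -/s -?sE //.
by rewrite /= index_mem.
Qed.

Variables (M : pmod k (R *p R)) (cM : S_constructible2 S M).

Fact slice_im_constructible (u v : R) (h : u <= v) : constructible1 (pim (phix M h)).
Proof.
have [gS M0 Mb] := cM; have [sS S0] := andP gS.
exists S; split=> // [a a0|i a b hab iS ca cb].
  apply/eqP; rewrite dimvf -leqn0 /dim /=.
  by rewrite (leq_trans (dimvS (subvf _))) // M0 //= a0 orbT.
have bij w : bijective (pmap M (slice_le w hab)).
  have [w0|[j jS cj]] := in_cell_dec w gS.
    by apply: bij_dim0; apply: M0; rewrite /= w0.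
  by apply: (Mb j i) => //; apply: cj.
have [g gK Kg] := bij u; have bv := bij v.
have natE x : pmap M (slice_le v hab) (phix M h a x) =
              phix M h b (pmap M (slice_le u hab) x).
  by have /lfunP/(_ x) := phix_nat M h hab; rewrite !comp_lfunE.
have injf : injective (pmap (pim (phix M h)) hab).
  move=> x y /(congr1 vsval); rewrite !pimE => /(bij_inj bv).
  exact: val_inj.
have surj y : exists x, pmap (pim (phix M h)) hab x = y.
  have /memv_imgP[w _ yE] := subvsP y.
  have aw : phix M h a (g w) \in limg (phix M h a) by rewrite memv_img ?memvf.
  exists (Subvs aw); apply: val_inj; rewrite [LHS]pimE /= natE Kg.
  by rewrite yE.
exists (fun y => sval (cid (surj y))) => y; last by case: cid.
by case: cid => x /= /injf.
Qed.

Definition mrk (I : bar) : Pvec :=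
  iclass (slice_im_constructible (mrk_end_ge I)).

(* The default value of [insubd] is only there to make the notation [p, q)
   total: it is used below for p < q only. *)
Definition bar_of (p : R) (q : \bar R) : bar :=
  insubd (@Bar (0, +oo%E) (ltry 0)) (p, q).

Definition mdgm (I : bar) : SPvec :=
  let rk p q : SPvec := to_groth (mrk (bar_of p q)) in
  let i := (index (bleft I) S).+1 in
  if bleft I \notin S then 0 else
  match bright I with
  | t%:E =>
      let j := (index t S).+1 in
      if t \notin S then 0 else
      rk (s i) (s j)%:E - rk (s i) (s j.+1)%:E
        + rk (s i.-1) (s j.+1)%:E - rk (s i.-1) (s j)%:E
  | +oo%E => rk (s i) +oo%E - rk (s i.-1) +oo%E
  | -oo%E => 0
  end.

(* The multiset unions of all the rectangles I x [a, b), for [a, b) a positive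
   (resp. negative) bar of mdgm I. They range over all of Dgm, but mdgm I, hence
   the multiset indexed by I, is nonzero for finitely many I only. *)
Definition pos_rects : {mset (pintv (R *p R))} :=
  \big[@msetD _/mset0]_(I \in [set: bar])
    seq_mset [seq rect I J | J <- pos_bars (mdgm I)].

Definition neg_rects : {mset (pintv (R *p R))} :=
  \big[@msetD _/mset0]_(I \in [set: bar])
    seq_mset [seq rect I J | J <- neg_bars (mdgm I)].

End MetaDiagram.

Lemma choices_inhabited (S : seq R) : grid S -> inhabited (choices S).
Proof.
case/andP=> sS S0.
pose s0 := nth 0 S 0 - 1; pose sN := last 0 S + 1.
pose d (I : bar) : R := fine (bright I) -
  Num.max (bleft I) (gpts S s0 sN (index (fine (bright I)) S)).
apply: inhabits; apply: (@Choices S s0 sN d).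
- by rewrite /s0 gtrBl.
- by rewrite /sN ltrDl.
move=> I [|i] //= iS bE.
have sE : gpts S s0 sN i.+1 = nth 0 S i by rewrite /gpts /= nth_rcons iS.
have uS : uniq S by move: sS; rewrite lt_sorted_uniq_le => /andP[].
have dE : d I = nth 0 S i - Num.max (bleft I) (gpts S s0 sN i).
  by rewrite /d bE /= sE index_uniq.
have lt1 : bleft I < nth 0 S i by rewrite -sE -lte_fin -bE; exact: barP.
have lt2 : gpts S s0 sN i < nth 0 S i.
  case: i iS {bE sE uS dE lt1} => [_|i iS]; first by rewrite /gpts /= /s0 gtrBl.
  rewrite /gpts /= nth_rcons (ltnW iS).
  by apply: (sorted_ltn_nth lt_trans) => //; rewrite inE // ltnW.
by rewrite sE dE subr_gt0 gt_max lt1 lt2 subKr !le_max !lexx orbT.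
Qed.

End Constructible.

(* Main.v *)
From HB Require Import structures.
From mathcomp Require Import all_boot all_order all_algebra generic_quotient.
From mathcomp Require Import finmap multiset.
From mathcomp Require Import boolp classical_sets fsbigop reals constructive_ereal.
From mathcomp Require Import zify.
Require Import Defs.

(** The rank of M between (a1, a2) and (b1, b2) is the rank, between the heights
    a2 and b2, of the image of the slice over a1 in the slice over b1. By
    constructibility it depends only on the grid cells p of a1 and q of b1, and
    it is then the value of the meta-rank at the interval running from the start
    of cell p to the end of cell q. So everything comes down to recovering the
    meta-rank from the meta-diagram, which is a Moebius inversion, and to reading
    off ranks from signed barcodes.

    Taking the rank between a2 and b2 is additive on direct sums and invariant
    under isomorphism, hence it extends to a homomorphism [rankG] from SPvec to
    the integers. On a difference of two modules that have barcodes it is the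
    number of bars of the first one that contain both a2 and b2, minus the same
    number for the second one ([rankG_bars]). A rectangle I x J contains both
    points iff I contains a1 and b1 and J contains a2 and b2, so the difference
    of the two ranks in the theorem is the sum of the values of [rankG] on the
    meta-diagram at all I containing a1 and b1. Only the intervals with ends in
    the grid contribute, and over these the sum telescopes in both ends to the
    single value of the meta-rank described above ([sum_rankG_mdgm]); the terms
    at s_0 vanish because M does to the left of s_1.

    Two facts about one-parameter modules support this. Every constructible
    module has a barcode ([barcode_exists]): a nonzero vector v born at the first
    point p where the module is nonzero spans an interval submodule, and a
    functional that is 1 on v at the last grid point where v is alive pulls back
    to a retraction onto it, because nothing exists before p; the complement is
    handled by induction on the dimension. And the signed barcode of 0 is empty
    ([signed_barcode0]), since two disjoint barcodes with equal rank invariants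
    are empty; without this the union over all intervals would not visibly be a
    finite one. *)

Set Implicit Arguments.
Unset Strict Implicit.
Unset Printing Implicit Defensive.

Import Order.TTheory GRing.Theory Num.Theory.
Import VectorInternalTheory.

Local Open Scope ring_scope.

(** * Ranks of linear maps *)

Section LinearMaps.
Variables (k : fieldType).

Lemma dim_limg_inj (U V W : vectType k) (f : 'Hom(U, V)) (g : 'Hom(V, W)) :
  injective g -> \dim (limg (g \o f)) = \dim (limg f).
Proof.
move=> /lker0P /eqP kg; rewrite limg_comp limg_dim_eq // kg.
by apply/eqP; rewrite -subv0 capvSr.
Qed.

Lemma limg_bij (U V : vectType k) (f : 'Hom(U, V)) : bijective f -> limg f = fullv.
Proof.
case=> g _ gK; apply/eqP; rewrite eqEsubv subvf; apply/subvP=> v _.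
by rewrite -(gK v) memv_img ?memvf.
Qed.

Lemma dim_limg_bij (U V W : vectType k) (f : 'Hom(U, V)) (g : 'Hom(V, W)) :
  bijective f -> \dim (limg (g \o f)) = \dim (limg g).
Proof. by move=> bf; rewrite limg_comp limg_bij. Qed.

Lemma dim0_eq0 (V : vectType k) (x : V) : \dim {:V} = 0%N -> x = 0.
Proof. by move/eqP; rewrite dimv_eq0 => /eqP V0; apply/eqP; rewrite -memv0 -V0 memvf. Qed.

Lemma dim_limg0l (U V : vectType k) (f : 'Hom(U, V)) :
  \dim {:U} = 0%N -> \dim (limg f) = 0%N.
Proof.
by move=> U0; apply/eqP; rewrite -leqn0 -U0 -(limg_ker_dim f fullv) leq_addl.
Qed.

Lemma linfun_linearE (U V : vectType k) (f : U -> V) : linear f -> linfun f =1 f.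
Proof.
move=> L; pose F : {linear _ -> _} := HB.pack f (GRing.isLinear.Build _ _ _ _ _ L).
exact: (lfunE F).
Qed.

Lemma bij_of_surj (U V : vectType k) (f : 'Hom(U, V)) :
  injective f -> (forall y, exists x, f x = y) -> bijective f.
Proof.
move=> fI fS; exists (fun y => sval (cid (fS y))) => [x|y]; last by case: cid.
by case: cid => x' /= /fI.
Qed.

Lemma exists_functional (V : vectType k) (u : V) :
  u != 0 -> exists lam : {linear V -> k^o}, lam u = 1.
Proof.
move=> u0; have /rV0Pn[j uj] : v2r u != 0.
  apply: contra u0 => /eqP v0; apply/eqP/(can_inj v2rK); rewrite v0.
  exact/esym/linear0.
pose l (w : V) : k^o := (v2r u 0 j)^-1 * v2r w 0 j.
have L : linear l by move=> a x y; rewrite /l linearP !mxE mulrDr mulrCA.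
pose lam : {linear V -> k^o} := HB.pack l (GRing.isLinear.Build _ _ _ _ _ L).
by exists lam; rewrite /= /l mulVf.
Qed.

End LinearMaps.

(** * The rank invariant of sums, intervals and images *)

Section Ranks.
Variables (k : fieldType) (d : Order.disp_t) (P : porderType d).
Implicit Types (M N : pmod k P).

Lemma pmap_irr M (p q : P) (h h' : (p <= q)%O) : pmap M h = pmap M h'.
Proof. by rewrite (bool_irrelevance h h'). Qed.

Lemma rank_inv_id M (p : P) : rank_inv M (lexx p) = \dim {:M p}.
Proof. by rewrite /rank_inv pmap1 lim1g. Qed.

Lemma rank_inv_iso M N (p q : P) (h : (p <= q)%O) :
  piso M N -> rank_inv M h = rank_inv N h.
Proof.
case=> f bf; rewrite /rank_inv -(dim_limg_inj (pmap M h) (bij_inj (bf q))).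
by rewrite pnat dim_limg_bij.
Qed.

(** The image of a direct sum of maps is the direct sum of the images, embedded
    by the two coordinate inclusions. *)
Lemma rank_inv_dsum M N (p q : P) (h : (p <= q)%O) :
  rank_inv (dsum M N) h = (rank_inv M h + rank_inv N h)%N.
Proof.
pose i1 (V W : vectType k) : 'Hom(V, (V * W)%type) := linfun (fun x : V => (x, 0 : W)).
pose i2 (V W : vectType k) : 'Hom(W, (V * W)%type) := linfun (fun x : W => (0 : V, x)).
have i1E (V W : vectType k) x : i1 V W x = (x, 0).
  by apply: linfun_linearE => a u v; congr pair; rewrite /= scaler0 addr0.
have i2E (V W : vectType k) x : i2 V W x = (0, x).
  by apply: linfun_linearE => a u v; congr pair; rewrite /= scaler0 addr0.
have j1 (V W : vectType k) : injective (i1 V W) by move=> x y; rewrite !i1E => -[].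
have j2 (V W : vectType k) : injective (i2 V W) by move=> x y; rewrite !i2E => -[].
have -> : rank_inv (dsum M N) h =
    \dim (limg (i1 _ _ \o pmap M h)%VF + limg (i2 _ _ \o pmap N h)%VF)%VS.
  rewrite /rank_inv; congr (\dim _); apply/eqP; rewrite eqEsubv; apply/andP; split.
    apply/subvP=> _ /memv_imgP[[x y] _ ->]; rewrite dsumE /=; apply/memv_addP.
    exists (i1 _ _ (pmap M h x)); first by rewrite -comp_lfunE memv_img ?memvf.
    exists (i2 _ _ (pmap N h y)); first by rewrite -comp_lfunE memv_img ?memvf.
    by rewrite i1E i2E; congr pair; rewrite /= ?addr0 ?add0r.
  rewrite subv_add; apply/andP; split; apply/subvP=> _ /memv_imgP[x _ ->].
    rewrite comp_lfunE i1E; have -> : (pmap M h x, 0) = pmap (dsum M N) h (x, 0).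
      by rewrite dsumE /= linear0.
    by rewrite memv_img ?memvf.
  rewrite comp_lfunE i2E; have -> : (0, pmap N h x) = pmap (dsum M N) h (0, x).
    by rewrite dsumE /= linear0.
  by rewrite memv_img ?memvf.
rewrite dimv_disjoint_sum ?dim_limg_inj //; [exact: j2 | exact: j1 |].
apply/eqP; rewrite -subv0; apply/subvP=> z; rewrite memv_cap memv0.
by case/andP=> /memv_imgP[x _ ->] /memv_imgP[y _]; rewrite !comp_lfunE i1E i2E => -[-> _].
Qed.

Lemma kint_bij (I : pintv P) (p q : P) (h : (p <= q)%O) :
  (p \in pset I) = (q \in pset I) -> bijective (pmap (kint I : pmod k P) h).
Proof.
move=> pq.
have E (r : 'rV[k]_(p \in pset I)) : kint_map I h r = castmx (erefl, congr1 nat_of_bool pq) r.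
  rewrite lfunE /=; apply/rowP=> j; rewrite !mxE castmxE.
  under eq_bigr do rewrite !mxE mulr1.
  move: r j (congr1 nat_of_bool pq) => + + e; move: e; rewrite -pq.
  case: (p \in pset I) => // [e r j|e r []//].
  by rewrite big_ord1 cast_ord_id !ord1; congr (r _ _).
exists (castmx (erefl, esym (congr1 nat_of_bool pq))) => r;
  by rewrite /= E castmx_comp castmx_id.
Qed.

Lemma rank_inv_kint (I : pintv P) (p q : P) (h : (p <= q)%O) :
  rank_inv (kint I : pmod k P) h = (p \in pset I) && (q \in pset I).
Proof.
have dimI r : \dim {:kint I r : vectType k} = (r \in pset I) by rewrite dimvf /dim /= mul1n.
case pI: (p \in pset I) => /=; last first.
  by rewrite /rank_inv dim_limg0l // dimI pI.
case qI: (q \in pset I); last first.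
  by apply/eqP; rewrite -leqn0 (leq_trans (dimvS (subvf _))) // dimI qI.
by rewrite /rank_inv limg_bij ?dimI ?qI //; apply: kint_bij; rewrite pI qI.
Qed.

Lemma rank_inv_kints (s : seq (pintv P)) (p q : P) (h : (p <= q)%O) :
  rank_inv (kints s : pmod k P) h = count (fun I => (p \in pset I) && (q \in pset I)) s.
Proof.
elim: s => [|I s IHs] /=; first by rewrite /rank_inv dim_limg0l // dimvf /dim /= mul1n.
by rewrite rank_inv_dsum rank_inv_kint IHs.
Qed.

(** The map of the image module is the map of the target, restricted to the image
    of f at p: its rank is that of the composite. *)
Lemma rank_inv_pim M N (f : pmor M N) (p q : P) (h : (p <= q)%O) :
  rank_inv (pim f) h = \dim (limg (pmap N h \o f p)%VF).
Proof.
pose v : 'Hom(subvs_of (limg (f q)), N q) := linfun vsval.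
have vE x : v x = vsval x by rewrite lfunE.
rewrite /rank_inv -(@dim_limg_inj _ _ _ _ _ v); last first.
  by move=> x y; rewrite !vE; apply: val_inj.
congr (\dim _); apply/eqP; rewrite eqEsubv; apply/andP; split; apply/subvP=> y.
  case/memv_imgP=> x _ ->; rewrite comp_lfunE vE pimE.
  by have /memv_imgP[w _ ->] := subvsP x; rewrite -comp_lfunE memv_img ?memvf.
case/memv_imgP=> w _ ->; rewrite comp_lfunE.
have fw : f p w \in limg (f p) by rewrite memv_img ?memvf.
have -> : pmap N h (f p w) = (v \o pmap (pim f) h)%VF (Subvs fw).
  by rewrite comp_lfunE vE pimE.
by rewrite memv_img ?memvf.
Qed.

End Ranks.

(** * Splitting off a retract *)

Section Splitting.
Variables (k : fieldType) (d : Order.disp_t) (P : porderType d).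

Section Kernel.
Variables (M N : pmod k P) (f : pmor M N).

Let ker p : vectType k := subvs_of (lker (f p)).

Definition pker_map (p q : P) (h : (p <= q)%O) : 'Hom(ker p, ker q) :=
  linfun (fun v => vsproj (lker (f q)) (pmap M h (vsval v))).

Lemma pker_mapE (p q : P) (h : (p <= q)%O) v :
  vsval (pker_map h v) = pmap M h (vsval v).
Proof.
rewrite linfun_linearE; last by move=> a x y; rewrite !linearP.
rewrite vsprojK // memv_ker -comp_lfunE pnat comp_lfunE.
by have := subvsP v; rewrite memv_ker => /eqP ->; rewrite linear0.
Qed.

Fact pker_map1 (p : P) (h : (p <= p)%O) : pker_map h = \1%VF.
Proof. by apply/lfunP=> x; apply/val_inj; rewrite /= pker_mapE pmap1 !id_lfunE. Qed.

Fact pker_mapD (p q r : P) (hpq : (p <= q)%O) (hqr : (q <= r)%O)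
  (hpr : (p <= r)%O) : pker_map hpr = (pker_map hqr \o pker_map hpq)%VF.
Proof.
apply/lfunP=> x; apply/val_inj.
by rewrite /= comp_lfunE !pker_mapE (pmapD _ hpq hqr) comp_lfunE.
Qed.

Definition pker : pmod k P := Pmod pker_map1 pker_mapD.

(** A split epimorphism f, with section g, decomposes its source as the direct sum
    of its target and its kernel. *)
Lemma piso_split (g : pmor N M) : (forall p x, f p (g p x) = x) -> piso M (dsum N pker).
Proof.
move=> gK; apply: piso_sym.
have L p : linear (fun x : (N p * ker p)%type => g p x.1 + vsval x.2).
  by move=> a u v; rewrite !linearP /= scalerDr addrACA.
pose F p : {linear _ -> _} :=
  HB.pack (fun x : (N p * ker p)%type => g p x.1 + vsval x.2)
    (GRing.isLinear.Build _ _ _ _ _ (L p)).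
apply: (@piso_build _ _ _ (dsum N pker) M F) => [p|p q h [x y]].
  exists (fun w => (f p w, vsproj (lker (f p)) (w - g p (f p w)))) => [[x y]|w] /=.
    have fy : f p (vsval y) = 0 by apply/eqP; rewrite -memv_ker subvsP.
    have -> : f p (g p x + vsval y) = x by rewrite linearD /= fy gK addr0.
    by rewrite addrAC subrr add0r vsvalK.
  by rewrite vsprojK ?memv_ker ?linearB /= ?gK ?subrr // addrC subrK.
rewrite dsumE /= pker_mapE linearD; congr (_ + _).
by rewrite -comp_lfunE pnat comp_lfunE.
Qed.

End Kernel.

(** The internal map of M between any two points, so that statements about several
    maps need not carry the proofs that they exist; 0 for points out of order. *)
Definition tmap (M : pmod k P) (p q : P) : 'Hom(M p, M q) :=
  if (p <= q)%O =P true is ReflectT h then pmap M h else 0.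

Lemma tmapE (M : pmod k P) (p q : P) (h : (p <= q)%O) : tmap M p q = pmap M h.
Proof. by rewrite /tmap; case: eqP => // h'; exact: pmap_irr. Qed.

Lemma tmapD (M : pmod k P) (p q r : P) v :
  (p <= q)%O -> (q <= r)%O -> tmap M p r v = tmap M q r (tmap M p q v).
Proof.
move=> pq qr; rewrite (tmapE _ pq) (tmapE _ qr) (tmapE _ (le_trans pq qr)).
by rewrite (pmapD _ pq qr) comp_lfunE.
Qed.

(** Right multiplication by an all-ones matrix adds up the entries. *)
Lemma pmap_kintE (I : pintv P) (p q : P) (h : (p <= q)%O) (r : 'rV[k]_(p \in pset I)) :
  pmap (kint I) h r = const_mx (\sum_j r 0 j).
Proof.
rewrite lfunE /=; apply/rowP=> j; rewrite !mxE.
by apply: eq_bigr => i _; rewrite mxE mulr1.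
Qed.

End Splitting.

(** * Rows of width 0 or 1, the spaces of interval modules *)

Section BooleanRows.
Variable k : fieldType.

Lemma row_bool_false (b : bool) (r r' : 'rV[k]_b) : b = false -> r = r'.
Proof. by move=> b0; move: r r'; rewrite b0 => r r'; apply/rowP; case. Qed.

Lemma const_mx_bool (b : bool) (r : 'rV[k]_b) : const_mx (\sum_j r 0 j) = r.
Proof.
by case: b r => r; apply/rowP; [move=> j; rewrite mxE big_ord1 !ord1 | case].
Qed.

Lemma sum_const_bool (b : bool) (a : k) : \sum_j (const_mx a : 'rV[k]_b) 0 j = a *+ b.
Proof. by under eq_bigr do rewrite mxE; rewrite sumr_const card_ord. Qed.

Lemma sum_bool0 (b : bool) (r : 'rV[k]_b) : b = false -> \sum_j r 0 j = 0.
Proof. by move=> b0; move: r; rewrite b0 => r; rewrite big_ord0. Qed.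

End BooleanRows.

(** * Barcodes of constructible one-parameter modules *)

Section OneParameter.
Variables (k : fieldType) (R : realType).
Implicit Types (N : pmod k R) (S : seq R).

Lemma S_constructible1_summand S (N A B : pmod k R) :
  S_constructible1 S N -> piso N (dsum A B) -> S_constructible1 S B.
Proof.
move=> [gS N0 Nb] [f bf]; split=> // [a aS|i a b h iS ca cb].
  have [g gK Kg] := bf a.
  apply/eqP; rewrite dimv_eq0 -subv0; apply/subvP=> y _; rewrite memv0.
  have /(congr1 (f a)) := dim0_eq0 (g (0, y)) (N0 a aS).
  by rewrite Kg linear0 => -[->].
have [g gK Kg] := bf a; have [g' gK' Kg'] := bf b.
have [m mK Km] := Nb i a b h iS ca cb.
have nat x : f b (pmap N h x) = pmap (dsum A B) h (f a x).
  by rewrite -comp_lfunE pnat comp_lfunE.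
apply: bij_of_surj => [x y xy|y].
  suff [] : (0, x) = (0, y) :> dsum A B a by [].
  apply: (can_inj Kg); apply: (can_inj mK); apply: (can_inj gK').
  by rewrite !nat !Kg !dsumE /= xy.
exists (f a (m (g' (0, y)))).2.
have := nat (m (g' (0, y))); rewrite Km Kg' dsumE.
by case.
Qed.

Lemma in_cell_nth S i : grid S -> (i < size S)%N -> in_cell S i (nth 0 S i).
Proof.
case/andP=> sS _ iS; apply/andP; split=> //.
have [jS|jS] := ltnP i.+1 (size S); last by rewrite [ltRHS]nth_default ?size_map // ltry.
by rewrite (nth_map 0) // lte_fin (sorted_ltn_nth lt_trans).
Qed.

(** The birth of a constructible module happens on the grid. The case p = size S
    says that a module vanishing on the grid is zero, which is why the bound on x
    is only required for p < size S. *)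
Lemma S_constructible1_dim0 S N p : S_constructible1 S N ->
  (forall i, (i < p)%N -> (i < size S)%N -> \dim {:N (nth 0 S i)} = 0%N) ->
  (p <= size S)%N -> forall x, ((p < size S)%N -> x < nth 0 S p) -> \dim {:N x} = 0%N.
Proof.
move=> [gS N0 Nb] Np pS x xp; have [sS _] := andP gS.
have [/N0 //|[j jS /(_ x) cj]] := in_cell_dec x gS.
have {}cj := cj (fun _ _ => erefl).
have jp : (j < p)%N.
  move: pS; rewrite leq_eqVlt => /orP[/eqP -> //|pS].
  move: (xp pS); rewrite ltNge (in_cell_le sS jS cj) ?mem_nth // -ltnNge.
  by rewrite index_uniq //; move: sS; rewrite lt_sorted_uniq_le => /andP[].
have h : nth 0 S j <= x by case/andP: cj.
rewrite -(limg_bij (Nb j _ _ h jS (in_cell_nth gS jS) cj)).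
exact/dim_limg0l/Np.
Qed.

(** The bar starts at the first grid point b where N is nonzero, and ends at the
    first grid point where v has died. Mapping 1 to v embeds the interval module in
    N; the retraction is a functional lam that is 1 on the image u of v in N at the
    last grid point e where v is alive, pulled back along the maps to e. Past e,
    but within the bar, N is constant and lam is pushed forward along the inverse
    isomorphisms. The only obstruction to naturality would be vectors of N born
    before b, and there are none. *)
Lemma split_bar S N p (v : N (nth 0 S p)) : S_constructible1 S N -> (p < size S)%N ->
    (forall i, (i < p)%N -> (i < size S)%N -> \dim {:N (nth 0 S i)} = 0%N) -> v != 0 ->
  exists (I : bar R) (K : pmod k R),
    bset I (nth 0 S p) /\ piso N (dsum (kint (bar_itv I)) K).
Proof.
move=> cN pS Np v0; have [gS N0 Nb] := cN; have [sS _] := andP gS.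
set b := nth 0 S p.
have Nb0 := S_constructible1_dim0 cN Np (ltnW pS).
pose alive m := [&& (p <= m)%N, (m < size S)%N & tmap N b (nth 0 S m) v != 0].
have exm : exists m, alive m.
  by exists p; rewrite /alive leqnn pS (tmapE _ (lexx _)) pmap1 id_lfunE.
have ubm m : alive m -> (m <= size S)%N by case/and3P=> _ /ltnW.
case: (ex_maxnP exm ubm) => m /and3P[pm mS tm] mmax.
set e := nth 0 S m in tm.
have be : b <= e by exact: sorted_nth_le.
have bI : (b%:E < nth +oo (map EFin S) m.+1)%E.
  have /andP[_] := in_cell_nth gS mS; apply: le_lt_trans; rewrite lee_fin //.
pose I := @Bar R (b, nth +oo%E (map EFin S) m.+1) bI.
have inI x : (x \in pset (bar_itv I)) = (b <= x) && (x%:E < nth +oo (map EFin S) m.+1)%E.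
  by apply/idP/idP => [/set_mem[? ?]|/andP[? ?]]; [apply/andP|apply/mem_set].
have dead y : b <= y -> y \notin pset (bar_itv I) -> tmap N b y v = 0.
  move=> yb; rewrite inI yb /=.
  have [jS|jS] := ltnP m.+1 (size S); last by rewrite [ltRHS]nth_default ?size_map // ltry.
  rewrite (nth_map 0) // lte_fin -leNgt => sy.
  have bs : b <= nth 0 S m.+1 by rewrite sorted_nth_le // (leq_trans pm).
  rewrite (tmapD _ bs sy); apply/eqP.
  suff /eqP -> : tmap N b (nth 0 S m.+1) v == 0 by rewrite linear0.
  apply/negPn/negP => h; have := mmax m.+1.
  by rewrite /alive jS h (leq_trans pm) // ltnn => /(_ isT).
have eb x : x \in pset (bar_itv I) -> bijective (tmap N e (Num.max x e)).
  rewrite inI => /andP[_ xm]; have h : e <= Num.max x e by rewrite le_max lexx orbT.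
  rewrite (tmapE _ h); apply: (Nb m) => //; first exact: in_cell_nth.
  apply/andP; split=> //; rewrite /Num.max; case: ifP => _ //.
  by case/andP: (in_cell_nth gS mS).
set u := tmap N b e v in tm.
have [lam lamu] := exists_functional tm.
(* Going through max x e covers both the points x before e and those after it. *)
pose fl x (w : N x) : k^o :=
  lam ((tmap N e (Num.max x e))^-1%VF (tmap N x (Num.max x e) w)).
have fl_lin x : linear (fl x) by move=> a y z; rewrite /fl !linearP.
pose f x : 'Hom(N x, 'rV[k]_(x \in pset (bar_itv I))) :=
  linfun (fun w => const_mx (fl x w)).
have fE x w : f x w = const_mx (fl x w).
  rewrite linfun_linearE // => a y z; rewrite fl_lin.
  by apply/matrixP=> i j; rewrite !mxE.
pose g x : 'Hom('rV[k]_(x \in pset (bar_itv I)), N x) :=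
  linfun (fun r : 'rV[k]_(x \in pset (bar_itv I)) => (\sum_j r 0 j) *: tmap N b x v).
have gE x r : g x r = (\sum_j r 0 j) *: tmap N b x v.
  rewrite linfun_linearE // => a y z; rewrite scalerA -scalerDl; congr (_ *: _).
  by rewrite mulr_sumr -big_split; apply: eq_bigr => j _; rewrite !mxE.
have inIl x y : x <= y -> x \notin pset (bar_itv I) -> y \in pset (bar_itv I) -> x < b.
  rewrite !inI => xy + /andP[yb ym]; rewrite negb_and -ltNge => /orP[//|/negP[]].
  by apply: le_lt_trans ym; rewrite lee_fin.
have fnat x y (h : x <= y) :
    (f y \o pmap N h = pmap (kint (bar_itv I) : pmod k R) h \o f x)%VF.
  apply/lfunP=> w; rewrite !comp_lfunE pmap_kintE !fE sum_const_bool.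
  case yI: (y \in pset (bar_itv I)); last exact: row_bool_false.
  congr const_mx; case: (boolP (x \in pset (bar_itv I))) => xI; last first.
    have -> : w = 0 by apply/dim0_eq0/Nb0 => _; apply: (inIl _ y).
    by rewrite !linear0 mulr0n /fl !linear0.
  rewrite mulr1n /fl -tmapE; congr (lam _).
  have eX : e <= Num.max x e by rewrite le_max lexx orbT.
  have xX : x <= Num.max x e by rewrite le_max lexx.
  have yY : y <= Num.max y e by rewrite le_max lexx.
  have eY : e <= Num.max y e by rewrite le_max lexx orbT.
  have XY : Num.max x e <= Num.max y e by rewrite ge_max eY (le_trans h yY).
  rewrite -(tmapD _ h yY) (tmapD _ xX XY).
  set w' := tmap N x _ w; have [h1 h1K Kh1] := eb x xI.
  rewrite -{1}(Kh1 w') -(tmapD _ eX XY).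
  have inv z (zI : z \in pset (bar_itv I)) a :
      (tmap N e (Num.max z e))^-1%VF (tmap N e (Num.max z e) a) = a.
    by rewrite lker0_lfunK //; apply/lker0P/bij_inj/eb.
  by rewrite inv ?yI // -{2}(Kh1 w') inv.
have gnat x y (h : x <= y) :
    (g y \o pmap (kint (bar_itv I) : pmod k R) h = pmap N h \o g x)%VF.
  apply/lfunP=> r; rewrite !comp_lfunE pmap_kintE !gE sum_const_bool linearZ /= -tmapE.
  have [xI|/negP/negbTE xI] := pselect (x \in pset (bar_itv I)); last first.
    by rewrite sum_bool0 // mul0rn !scale0r.
  have bx : b <= x by move: xI; rewrite inI => /andP[].
  rewrite -(tmapD _ bx h); case: (boolP (y \in pset (bar_itv I))) => yI //.
  by rewrite (dead y) ?scaler0 // (le_trans bx).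
have fgK x r : f x (g x r) = r.
  rewrite fE gE.
  have [xI|/negP/negbTE xI] := pselect (x \in pset (bar_itv I)); last first.
    exact: row_bool_false.
  have bx : b <= x by move: xI; rewrite inI => /andP[].
  have eX : e <= Num.max x e by rewrite le_max lexx orbT.
  have xX : x <= Num.max x e by rewrite le_max lexx.
  rewrite /fl linearZ /= -(tmapD _ bx xX) (tmapD _ be eX) linearZ /=.
  rewrite lker0_lfunK; last exact/lker0P/bij_inj/eb.
  by rewrite linearZ /= lamu [_%:A]mulr1 const_mx_bool.
exists I, (pker (@Pmor _ _ _ N (kint (bar_itv I)) f fnat)); split.
  by split=> //; exact: lexx.
exact: (@piso_split _ _ _ _ _ _ (@Pmor _ _ _ (kint (bar_itv I)) N g gnat)).
Qed.

(** Each bar that is split off contains a grid point, so the total dimension of the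
    module over the grid decreases. *)
Lemma barcode_exists (N : pmod k R) : constructible1 N ->
  exists s : seq (bar R), piso N (kints (map (@bar_itv R) s)).
Proof.
move=> [S]; have [n] := ubnP (\sum_(i < size S) \dim {:N (nth (0%R : R) S i)})%N.
elim: n => // n IHn in N *; rewrite ltnS => dn cN; have [gS N0 Nb] := cN.
have [|] := pselect (exists i, (i < size S)%N && (\dim {:N (nth 0 S i)} != 0%N)); last first.
  move=> noi; exists [::].
  have N00 x : \dim {:N x} = 0%N.
    apply: (S_constructible1_dim0 cN (p := size S)) => // [i _ iS|]; last by rewrite ltnn.
    by apply/eqP/negPn/negP => h; apply: noi; exists i; rewrite iS.
  pose F x : {linear N x -> 'rV[k]_0} := HB.pack (fun _ : N x => (0 : 'rV[k]_0))
    (GRing.isLinear.Build _ _ _ _ _ (fun a _ _ => esym (etrans (addr0 _) (scaler0 _ a)))).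
  apply: (@piso_build _ _ _ N pmod0 F) => [x|x y h z].
    exists (fun=> 0) => z; first by rewrite [z]dim0_eq0.
    by apply/rowP; case.
  by apply/rowP; case.
move=> exi; case: (ex_minnP exi) => p /andP[pS dp] pmin.
have [v v0] : exists v : N (nth 0 S p), v != 0.
  move: dp; rewrite dimv_eq0 -vpick0 => vp; by exists (vpick {:N (nth 0 S p)}).
have [|I [K [Ip iK]]] := split_bar cN pS _ v0.
  move=> i ip iS; apply/eqP/negPn/negP => h; have := pmin i.
  by rewrite iS h leqNgt ip => /(_ isT).
have cK := S_constructible1_summand cN iK.
suff /IHn/(_ cK)[s iS] : (\sum_(i < size S) \dim {:K (nth (0%R : R) S i)} < n)%N.
  by exists (I :: s); apply: piso_trans iK _; apply: dsum_iso => //; exact: piso_refl.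
have dimN x : \dim {:N x} = ((x \in pset (bar_itv I)) + \dim {:K x})%N.
  by rewrite -!rank_inv_id (rank_inv_iso _ iK) rank_inv_dsum rank_inv_kint andbb.
apply: leq_trans dn.
rewrite (bigD1 (Ordinal pS)) //= [ltnRHS](bigD1 (Ordinal pS)) //= -addSn leq_add //.
  by rewrite dimN (mem_set Ip).
by apply: leq_sum => i _; rewrite dimN leq_addl.
Qed.

End OneParameter.

(** * Ranks and bars of elements of the Grothendieck group *)

Local Open Scope quotient_scope.

(** The interval module on I has rank 1 between a and b iff I spans them. *)
Definition spans (R : realType) (a b : R) (I : bar R) : bool :=
  (a \in pset (bar_itv I)) && (b \in pset (bar_itv I)).

Section GrothendieckRank.
Variables (k : fieldType) (R : realType).

Section Rank.
Variables (a b : R) (h : (a <= b)%O).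

Definition rankP (x : Pvec k R) : int := (rank_inv (pmod_of (cval (repr x))) h)%:Z.

Lemma rankP_iclass (M : pmod k R) (cM : constructible1 M) :
  rankP (iclass cM) = (rank_inv M h)%:Z.
Proof.
rewrite /rankP (rank_inv_iso h (N := M)) //.
exact/(iclass_eqP (cvalP _) cM)/iclass_repr.
Qed.

Lemma rankPD x y : rankP (x + y) = rankP x + rankP y.
Proof. by rewrite -[x + y]/(Pvec_add x y) rankP_iclass rank_inv_dsum PoszD. Qed.

Lemma rankP0 : rankP 0 = 0.
Proof. by have := rankPD 0 0; rewrite addr0; lia. Qed.

Definition rankG (A : SPvec k R) : int := rankP (repr A).1 - rankP (repr A).2.

Lemma rankG_pi (x y : Pvec k R) :
  rankG (\pi_(groth (Pvec k R)) (x, y)) = rankP x - rankP y.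
Proof.
rewrite /rankG; case: piP => -[x' y'] /eqP/groth_eqP[e /= /(congr1 rankP)].
by rewrite !rankPD => /addIr; lia.
Qed.

Lemma rankG_to_groth x : rankG (to_groth x) = rankP x.
Proof. by rewrite rankG_pi rankP0 subr0. Qed.

Lemma rankGD A B : rankG (A + B) = rankG A + rankG B.
Proof.
rewrite -[A]reprK -[B]reprK; case: (repr A) (repr B) => [x y] [x' y'].
have -> : \pi_(groth (Pvec k R)) (x, y) + \pi_(groth (Pvec k R)) (x', y') =
          \pi_(groth (Pvec k R)) (x + x', y + y').
  by rewrite -[LHS]/(groth_add _ _) piE.
by rewrite !rankG_pi !rankPD; lia.
Qed.

Lemma rankG0 : rankG 0 = 0.
Proof. by have := rankGD 0 0; rewrite addr0; lia. Qed.

Lemma rankGB A B : rankG (A - B) = rankG A - rankG B.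
Proof. by have := rankGD (A - B) B; rewrite subrK; lia. Qed.

End Rank.

(** The ends of the bar form a grid for its interval module. *)
Lemma constructible_kint (I : bar R) : constructible1 (kint (bar_itv I) : pmod k R).
Proof.
case: I => -[p q] pq.
pose S := p :: (if q is d%:E then [:: d] else [::]).
have gS : grid S by rewrite /S; case: q pq {S} => [d||] //=; rewrite /grid /= lte_fin => ->.
exists S; split=> // [a ap|i a b h iS ca cb].
  rewrite dimvf /dim /= mul1n; apply/eqP; rewrite eqb0; apply/negP=> /set_mem[] /=.
  by rewrite /bleft /= leNgt ap.
have sS : sorted <%R S by case/andP: gS.
have same s : s \in S -> (s <= a) = (s <= b).
  by move=> sS'; rewrite (in_cell_le sS iS ca sS') (in_cell_le sS iS cb sS').
have inE x : (x \in pset (bar_itv (Bar pq))) = (p <= x) && (x%:E < q)%E.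
  by apply/idP/idP => [/set_mem[? ?]|/andP[? ?]]; [apply/andP|apply/mem_set].
apply: kint_bij; rewrite !inE same ?mem_head //; congr (_ && _).
case: q pq @S gS iS ca cb same sS {inE} => [d||] pq S gS iS ca cb same sS //; last first.
  by rewrite !ltry.
by rewrite !lte_fin !ltNge same // !inE eqxx orbT.
Qed.

Lemma constructible_kints (s : seq (bar R)) :
  constructible1 (kints (map (@bar_itv R) s) : pmod k R).
Proof.
elim: s => [|I s IHs] /=; first exact: constructible_pmod0.
by apply: constructible_dsum => //; exact: constructible_kint.
Qed.

(** In Pvec the order of the summands does not matter: this turns barcodes, which
    are multisets, into classes. *)
Lemma iclass_kints (s : seq (bar R)) :
  iclass (constructible_kints s) = \sum_(I <- s) iclass (constructible_kint I).
Proof.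
elim: s => [|I s IHs].
  by rewrite big_nil; apply/iclass_eqP/piso_refl.
rewrite big_cons -IHs -[RHS]/(Pvec_add _ _) iclass_dsum.
by apply/iclass_eqP/piso_refl.
Qed.

End GrothendieckRank.

Section SignedBarcodes.
Variables (k : fieldType) (R : realType).
Local Open Scope mset_scope.

(** The chosen signed barcode of A is not the default value: write A as a difference
    of two modules, take their barcodes, and remove their intersection from both. *)
Lemma signed_barcodeP (A : SPvec k R) :
  exists (Mp Mn : pmod k R) (cp : constructible1 Mp) (cn : constructible1 Mn),
    [/\ A = \pi_(groth (Pvec k R)) (iclass cp, iclass cn),
        is_barcode Mp (pos_bars A), is_barcode Mn (neg_bars A)
      & pos_bars A `&` neg_bars A = mset0].
Proof.
rewrite /pos_bars /neg_bars /signed_barcode; set X := (X in xget _ X).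
suff [B XB] : exists B, X B by exact: (xgetPex (mset0, mset0) (ex_intro _ B XB)).
pose cls (s : seq (bar R)) : Pvec k R := \sum_(I <- s) iclass (constructible_kint k I).
have barcode (x : Pvec k R) : exists B : {mset bar R}, x = cls B.
  have [s xs] := barcode_exists (cvalP (repr x)); exists (seq_mset s).
  rewrite -{1}[x]iclass_repr /cls (perm_big _ (perm_eq_seq_mset s)) -iclass_kints.
  exact/iclass_eqP.
have [[x y] AE] : exists u, A = \pi_(groth (Pvec k R)) u by exists (repr A); rewrite reprK.
have [Bx xE] := barcode x; have [By yE] := barcode y.
pose C := Bx `&` By.
have clsD (B : {mset bar R}) : (forall I, C I <= B I)%N -> cls B = cls (B `\` C) + cls C.
  move=> CB; rewrite /cls -big_cat; apply: perm_big; apply/allP => I _ /=.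
  by rewrite count_cat !count_mem_mset msetE2 subnK.
exists (Bx `\` C, By `\` C); rewrite /X /=.
exists (kints (map (@bar_itv R) (Bx `\` C))), (kints (map (@bar_itv R) (By `\` C))).
exists (constructible_kints k _), (constructible_kints k _); split; last first.
- by apply/msetP=> I; rewrite !msetE2 mset0E; lia.
- exact: piso_refl.
- exact: piso_refl.
rewrite AE; apply/eqP/groth_eqP; exists 0; rewrite !addr0 /= !iclass_kints.
rewrite -/(cls (Bx `\` C)) -/(cls (By `\` C)) xE yE.
rewrite (clsD Bx) => [|I]; last by rewrite msetE2 geq_minl.
rewrite (clsD By) => [|I]; last by rewrite msetE2 geq_minr.
by rewrite addrAC addrA.
Qed.

Lemma rankG_bars (A : SPvec k R) (a b : R) (h : (a <= b)%O) :
  rankG h A = (count (spans a b) (pos_bars A))%:Z - (count (spans a b) (neg_bars A))%:Z.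
Proof.
have [Mp [Mn [cp [cn [AE bp bn _]]]]] := signed_barcodeP A.
by rewrite {1}AE rankG_pi !rankP_iclass (rank_inv_iso h bp) (rank_inv_iso h bn)
  !rank_inv_kints !count_map.
Qed.

Lemma seq_min (T : eqType) (r : rel T) (s : seq T) : total r -> transitive r ->
  s != [::] -> exists2 x, x \in s & forall y, y \in s -> r x y.
Proof.
move=> rtot rtr; elim: s => // x s IHs _; have [->|/IHs[z zs zmin]] := eqVneq s [::].
  exists x; rewrite ?mem_head // => y; rewrite inE => /eqP ->.
  by have := rtot x x; rewrite orbb.
have /orP[xz|zx] := rtot x z.
  exists x; rewrite ?mem_head // => y; rewrite inE => /orP[/eqP ->|/zmin].
    by have := rtot x x; rewrite orbb.
  exact: rtr.
exists z; first by rewrite inE zs orbT.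
by move=> y; rewrite inE => /orP[/eqP ->|/zmin].
Qed.

(** A point of I so close to its right end that every bar reaching past that point
    ends no earlier than I does. *)
Lemma bar_point_past (I : bar R) (s : seq (bar R)) : exists2 b, bset I b &
  forall J, J \in s -> (bright J < bright I)%E -> (bright J <= b%:E)%E.
Proof.
elim: s => [|J s [b [Ib bI] bs]]; first by exists (bleft I); [exact: bset_left|].
have [JI|IJ] := ltP (bright J) (bright I); last first.
  exists b; first by split.
  by move=> K; rewrite inE => /orP[/eqP -> /(le_lt_trans IJ)|/bs //]; rewrite ltxx.
have [d dE] : exists d, bright J = d%:E.
  case: (bright J) JI (barP J : (_ < bright J)%E) => [d||] //; first by exists d.
  by rewrite ltNge leey.
exists (Num.max b d).
  split; first by rewrite le_max Ib.
  by case: (leP b d) => _ //; rewrite -dE.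
move=> K; rewrite inE => /orP[/eqP -> _|Ks KI].
  by rewrite dE lee_fin le_max lexx orbT.
by rewrite (le_trans (bs K Ks KI)) // lee_fin le_max lexx.
Qed.

(** Among all the bars with the least left end, let I be one with the largest right
    end. The only bar spanning the left end of I and a point close to its right end
    is I itself, so the ranks count the multiplicities of I in B and in C; these
    agree, and one of them is 0. *)
Lemma disjoint_bars (B C : {mset bar R}) : B `&` C = mset0 ->
    (forall a b : R, a <= b -> count (spans a b) B = count (spans a b) C) ->
  B = mset0.
Proof.
move=> BC0 BC; apply/msetP=> I0; rewrite mset0E; apply/eqP; rewrite mset_eq0.
apply/negP=> I0B.
have I0s : I0 \in B ++ C by rewrite mem_cat I0B.
have BCn : B ++ C != [::] :> seq _ by apply/eqP=> e; rewrite e in I0s.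
have [||I1 I1s leftmin] := @seq_min _ (fun I J => bleft I <= bleft J) (B ++ C) _ _ BCn.
- by move=> I J; exact: le_total.
- by move=> I J K; exact: le_trans.
pose s := [seq J <- B ++ C | bleft J == bleft I1].
have [|||I Is rightmax] := @seq_min _ (fun I J : bar R => (bright J <= bright I)%E) s.
- by move=> I J; exact: le_total.
- by move=> I J K h1 h2; exact: le_trans h2 h1.
- apply/eqP=> s0; have := mem_filter (fun J => bleft J == bleft I1) I1 (B ++ C).
  by rewrite -/s s0 I1s eqxx.
have [/eqP II1 Is'] : bleft I == bleft I1 /\ I \in B ++ C.
  by move: Is; rewrite mem_filter => /andP.
have [b Ib near] := bar_point_past I (B ++ C).
have only J : J \in B ++ C -> spans (bleft I) b J = (J == I).
  move=> Js; apply/andP/eqP=> [[/set_mem[lJ _] /set_mem[_ bJ]]|->]; last first.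
    by split; apply/mem_set => //; exact: bset_left.
  have lE : bleft J = bleft I by apply/eqP; rewrite eq_le lJ II1 leftmin.
  have rle : (bright J <= bright I)%E by apply: rightmax; rewrite mem_filter lE II1 eqxx.
  have rge : (bright I <= bright J)%E.
    by rewrite leNgt; apply/negP => /(near J Js); rewrite leNgt bJ.
  have rE : bright J = bright I by apply/eqP; rewrite eq_le rle.
  by apply: val_inj; rewrite /= [LHS]surjective_pairing [RHS]surjective_pairing; congr pair.
have cE (D : {mset bar R}) : {subset D <= B ++ C} -> count (spans (bleft I) b) D = D I.
  move=> sD; rewrite -count_mem_mset; apply: eq_in_count => J /sD; exact: only.
have lb : bleft I <= b by case: Ib.
have := BC _ _ lb; rewrite !cE => [eBC|J|J]; try by rewrite mem_cat => ->; rewrite ?orbT.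
have := congr1 (fun D : {mset bar R} => D I) BC0; rewrite /= msetE2 eBC minnn mset0E => C0.
by move: Is'; rewrite mem_cat !in_mset eBC C0.
Qed.

(** This makes the multiset of rectangles over I empty for all but finitely many I,
    so that the unions over all of Dgm are genuine finite unions. *)
Lemma signed_barcode0 : pos_bars (0 : SPvec k R) = mset0 /\ neg_bars (0 : SPvec k R) = mset0.
Proof.
have [_ [_ [_ [_ [_ _ _ dis]]]]] := signed_barcodeP 0.
have eqc a b : a <= b -> count (spans a b) (pos_bars (0 : SPvec k R)) =
    count (spans a b) (neg_bars (0 : SPvec k R)).
  by move=> h; have := rankG_bars 0 h; rewrite rankG0; lia.
split; first exact: disjoint_bars dis eqc.
apply: (@disjoint_bars _ (pos_bars (0 : SPvec k R))) => [|a b h]; first by rewrite msetIC.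
by rewrite eqc.
Qed.

End SignedBarcodes.

(** * Counting in finitely supported unions of multisets *)

Section MsetSum.
Local Open Scope mset_scope.

Lemma count_msetD (K : choiceType) (p : pred K) (A B : {mset K}) :
  count p (A `+` B) = (count p A + count p B)%N.
Proof.
rewrite -count_cat; apply/permP/allP => x _ /=.
by rewrite count_cat !count_mem_mset msetE2.
Qed.

HB.instance Definition _ (K : choiceType) :=
  Monoid.isComLaw.Build {mset K} mset0 (@msetD K) (@msetDA K) (@msetDC K) (@mset0D K).

Lemma count_fsbig_mset (T K : choiceType) (p : pred K) (L : seq T) (B : T -> {mset K}) :
  uniq L -> (forall I, I \notin L -> B I = mset0) ->
  count p (\big[@msetD _/mset0]_(I \in [set: T]) B I)%classic = (\sum_(I <- L) count p (B I))%N.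
Proof.
move=> uL B0; rewrite (fsbigE L) //= => [|I _]; last exact: B0.
elim: L {uL B0} => [|I L IHL]; first by rewrite !big_nil enum_mset0.
by rewrite !big_cons mem_set // count_msetD IHL.
Qed.

End MsetSum.

(** * Intervals with ends in the grid *)

Section Grid.
Variables (R : realType) (S : seq R).
Hypothesis gS : grid S.

Lemma bends_bar_of (p : R) (q : \bar R) : (p%:E < q)%E -> bends (bar_of p q) = (p, q).
Proof. by move=> pq; rewrite /bar_of; exact: (@insubdK _ _ (bar R)). Qed.

Lemma grid_sorted : sorted <%R S. Proof. by case/andP: gS. Qed.

Lemma grid_size : (0 < size S)%N.
Proof. by case/andP: gS => _; rewrite -size_eq0 lt0n. Qed.

Lemma grid_uniq : uniq S.
Proof. by move: grid_sorted; rewrite lt_sorted_uniq_le => /andP[]. Qed.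

Lemma in_cell_ge (u : R) : last 0 S <= u -> in_cell S (size S).-1 u.
Proof.
move=> lu; apply/andP; split; first by rewrite nth_last.
by rewrite prednK ?grid_size // [ltRHS]nth_default ?size_map // ltry.
Qed.

(** For j = size S the right end is the default value +oo, so that pairs i < j <=
    size S enumerate the bounded and the unbounded intervals uniformly. *)
Definition gbar (i j : nat) : bar R := bar_of (nth 0 S i) (nth +oo%E (map EFin S) j).

Lemma bends_gbar i j : (i < j)%N -> (i < size S)%N ->
  bends (gbar i j) = (nth 0 S i, nth +oo%E (map EFin S) j).
Proof.
move=> ij iS; apply: bends_bar_of; have [jS|jS] := ltnP j (size S); last first.
  by rewrite [ltRHS]nth_default ?size_map // ltry.
by rewrite (nth_map 0) // lte_fin (sorted_ltn_nth lt_trans) ?grid_sorted.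
Qed.

Definition gbars : seq (bar R) :=
  [seq gbar i j | i <- iota 0 (size S), j <- iota i.+1 (size S - i)].

Lemma uniq_gbars : uniq gbars.
Proof.
have uS := grid_uniq.
apply: allpairs_uniq_dep; [exact: iota_uniq | by move=> *; exact: iota_uniq |].
move=> _ _ /allpairsPdep[i [j [iS jS ->]]] /allpairsPdep[i' [j' [i'S j'S ->]]] /=.
move: iS jS i'S j'S; rewrite !mem_iota.
move=> /andP[_ iS] /andP[ij jS] /andP[_ i'S] /andP[ij' j'S].
rewrite !add0n in iS i'S; move=> /(congr1 (@bends R)); rewrite !bends_gbar // => -[/eqP].
rewrite nth_uniq // => /eqP ii' /(congr1 (index^~ (map EFin S))).
have indexE m : (m <= size S)%N -> index (nth +oo%E (map EFin S) m) (map EFin S) = m.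
  rewrite leq_eqVlt => /orP[/eqP ->|mS].
    rewrite nth_default ?size_map // memNindex ?size_map //.
    by apply/negP=> /mapP[].
  by rewrite index_uniq ?size_map // map_inj_uniq // => u v [].
by rewrite !indexE => [->||]; [rewrite ii'| lia | lia].
Qed.

Variable c : choices S.

Let s := gpts S (cfirst c) (clast c).

Lemma gptsS i : (i < size S)%N -> s i.+1 = nth 0 S i.
Proof. by move=> iS; rewrite /s /gpts /= nth_rcons iS. Qed.

Lemma gpts_last : s (size S).+1 = clast c.
Proof. by rewrite /s /gpts /= nth_rcons ltnn eqxx. Qed.

Lemma clast_notin : clast c \notin S.
Proof.
apply/negP=> h; have := clast_gt c; rewrite ltNge -(nth_last 0) -(nth_index 0 h).
by rewrite sorted_nth_le ?grid_sorted // -ltnS prednK ?grid_size ?index_mem.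
Qed.

Lemma gpts_lt j : (j < size S)%N -> nth 0 S j < s j.+2.
Proof.
move=> jS; have [j1S|] := ltnP j.+1 (size S).
  by rewrite gptsS // (sorted_ltn_nth lt_trans) ?grid_sorted.
rewrite leq_eqVlt => /orP[/eqP jE|]; last by rewrite ltnS leqNgt jS.
have -> : nth 0 S j = last 0 S by rewrite -(nth_last 0) jE.
by rewrite -jE gpts_last clast_gt.
Qed.

Lemma gpts_le i j : (i <= j.+1)%N -> (j < size S)%N -> s i <= nth 0 S j.
Proof.
case: i => [_ jS|i]; last first.
  by move=> ij jS; rewrite gptsS ?sorted_nth_le ?grid_sorted // (leq_trans ij).
by rewrite (le_trans (ltW (cfirst_lt c))) // sorted_nth_le ?grid_sorted.
Qed.

End Grid.

Section MetaDiagramSupport.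
Variables (k : fieldType) (R : realType) (S : seq R) (M : pmod k (R *p R)%type).
Variables (cM : S_constructible2 S M) (c : choices S).

Lemma grid_constructible : grid S. Proof. by case: cM. Qed.
Let gS := grid_constructible.

Lemma mdgm_off_grid (I : bar R) :
  I \notin gbars S -> mdgm c cM I = 0.
Proof.
move=> IL; rewrite /mdgm; case: ifPn => // /negPn lS.
have iS : (index (bleft I) S < size S)%N by rewrite index_mem.
have key j : (index (bleft I) S < j <= size S)%N ->
    bright I = nth +oo%E (map EFin S) j -> False.
  move=> /andP[ij jS] rE; case/negP: IL; apply/allpairsPdep.
  exists (index (bleft I) S), j; split; rewrite ?mem_iota //; first by lia.
  apply: val_inj; rewrite /= bends_gbar // nth_index // -rE.
  exact: surjective_pairing.
case E: (bright I) => [t||] //; last first.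
  case: (key (size S)); rewrite ?iS ?leqnn //.
  by rewrite nth_default ?size_map // E.
case: ifPn => // /negPn tS; have tiS : (index t S < size S)%N by rewrite index_mem.
case: (key (index t S)); last by rewrite (nth_map 0) // nth_index // E.
rewrite (ltnW tiS) andbT ltnNge; apply/negP=> ti.
have := barP I; rewrite -/(bleft I) -/(bright I) E lte_fin ltNge.
by rewrite -(nth_index 0 tS) -(nth_index 0 lS) sorted_nth_le ?(grid_sorted gS) // nth_index.
Qed.

End MetaDiagramSupport.

(** * Meta-ranks, and telescoping the meta-diagram *)

Lemma sum_above (n q : nat) (F : nat -> int) i : (i <= q)%N -> (q < n)%N ->
  \sum_(i.+1 <= j < n.+1) (if (q < j)%N then F j else 0) = \sum_(q <= j < n) F j.+1.
Proof.
move=> iq qn; rewrite (big_cat_nat (n := q.+1)) //=; last exact: ltnW.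
rewrite big_nat big1 ?add0r => [|j /andP[_ jq]]; last by rewrite ltnNge -ltnS jq.
rewrite big_add1 /= !big_nat; apply: eq_bigr => j /andP[qj _].
by rewrite ltnS qj.
Qed.

Section MetaRank.
Variables (k : fieldType) (R : realType) (S : seq R) (M : pmod k (R *p R)%type).
Hypothesis cM : S_constructible2 S M.
Variables (y z : R) (yz : y <= z).

Let P := (R *p R)%type.

(** The rank of M between two points at the fixed heights y and z, as a function of
    their abscissas only. *)
Definition hrank (u v : R) : int := (\dim (limg (tmap M ((u, y) : P) ((v, z) : P))))%:Z.

Lemma hrankE (u v : R) (h : (((u, y) : P) <= ((v, z) : P))%O) :
  hrank u v = (rank_inv M h)%:Z.
Proof. by rewrite /hrank tmapE. Qed.

Lemma prod_le (u v y' z' : R) : u <= v -> y' <= z' -> (((u, y') : P) <= ((v, z') : P))%O.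
Proof. by move=> uv yz'; rewrite leEprod /= uv. Qed.

Lemma shift_bij (w u u' : R) (i : nat) (h : u <= u') : (i < size S)%N ->
  in_cell S i u -> in_cell S i u' -> bijective (pmap M (shift_le w h)).
Proof.
move=> iS iu iu'; have [gS M0 Mb] := cM.
have [w0|[j jS cj]] := in_cell_dec w gS.
  by apply: bij_dim0; apply: M0; rewrite /= w0 orbT.
by apply: (Mb i j) => //; apply: cj.
Qed.

Lemma hrank_shiftl (u u' v : R) i : (i < size S)%N -> in_cell S i u -> in_cell S i u' ->
  u <= u' -> u' <= v -> hrank u v = hrank u' v.
Proof.
move=> iS cu cu' uu' u'v.
rewrite (hrankE (prod_le (le_trans uu' u'v) yz)) (hrankE (prod_le u'v yz)).
rewrite /rank_inv (pmapD M (shift_le y uu') (prod_le u'v yz)).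
by rewrite dim_limg_bij //; exact: (shift_bij y uu' iS).
Qed.

Lemma hrank_shiftr (u v v' : R) j : (j < size S)%N -> in_cell S j v -> in_cell S j v' ->
  u <= v -> v <= v' -> hrank u v = hrank u v'.
Proof.
move=> jS cv cv' uv vv'.
rewrite (hrankE (prod_le uv yz)) (hrankE (prod_le (le_trans uv vv') yz)).
rewrite /rank_inv (pmapD M (prod_le uv yz) (shift_le z vv')).
by rewrite dim_limg_inj //; exact/bij_inj/(shift_bij z vv' jS).
Qed.

Lemma hrank_cell (u u' v v' : R) i j : (i < size S)%N -> (j < size S)%N ->
  in_cell S i u -> in_cell S i u' -> in_cell S j v -> in_cell S j v' ->
  u <= v -> u' <= v' -> hrank u v = hrank u' v'.
Proof.
move=> iS jS cu cu' cv cv' uv u'v'.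
wlog uu' : u u' v v' cu cu' cv cv' uv u'v' / u <= u'.
  by move=> W; case: (leP u u') => [|/ltW] h; [|apply/esym]; apply: W.
have uv' := le_trans uu' u'v'.
rewrite -(hrank_shiftl iS cu cu' uu' u'v').
case: (leP v v') => [h|/ltW h]; first exact: (hrank_shiftr jS cv cv').
by apply/esym; apply: (hrank_shiftr jS cv' cv).
Qed.

Lemma hrank_outside (u v : R) : u < nth 0 S 0 -> hrank u v = 0.
Proof.
by move=> u0; case: cM => _ M0 _; rewrite /hrank dim_limg0l // M0 //= u0.
Qed.

Variable c : choices S.
Let gS := grid_constructible cM.
Let s := gpts S (cfirst c) (clast c).
Let sE i : (i < size S)%N -> s i.+1 = nth 0 S i := @gptsS _ _ c i.

(** The rank, from height y to height z, of the image of one slice in another is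
    the rank of M between the corresponding points of the plane. *)
Lemma rankG_mrk (I : bar R) :
  rankG yz (to_groth (mrk c cM I)) = hrank (bleft I) (mrk_end c I).
Proof.
rewrite rankG_to_groth rankP_iclass rank_inv_pim (hrankE (prod_le (mrk_end_ge c I) yz)).
by rewrite /rank_inv (pmapD M (shift_le y (mrk_end_ge c I)) (slice_le (mrk_end c I) yz)).
Qed.

Lemma hrank_gpts i j v : (i <= j.+1)%N -> (j < size S)%N -> in_cell S j v -> s i <= v ->
  hrank (s i) v = hrank (s i) (nth 0 S j).
Proof.
move=> ij jS cv iv; case: i ij iv => [_ _|i ij iv]; first by rewrite !hrank_outside ?cfirst_lt.
have iS : (i < size S)%N by apply: leq_ltn_trans jS; exact: ij.
apply: (hrank_cell iS jS) => //; rewrite ?sE //; try exact: in_cell_nth.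
exact: (sorted_nth_le (grid_sorted gS)).
Qed.

(** Writing s_i for the points of the grid extended by s_0 and s_(n+1), the
    meta-rank at [s_i, s_(j+2)) is taken at a point of the cell from s_(j+1) to
    s_(j+2), whatever the choice of delta, or of s_(n+1) in the last cell. As S is
    indexed from 0, its entry j is s_(j+1). *)
Lemma rankG_mrk_fin i j : (i <= j.+1)%N -> (j < size S)%N ->
  rankG yz (to_groth (mrk c cM (bar_of (s i) (s j.+2)%:E))) = hrank (s i) (nth 0 S j).
Proof.
move=> ij jS; have ilt : ((s i)%:E < (s j.+2)%:E)%E.
  by rewrite lte_fin (le_lt_trans (gpts_le gS c ij jS)) // (gpts_lt gS).
set I := bar_of _ _; have bE : bends I = (s i, (s j.+2)%:E) by exact: bends_bar_of.
have lE : bleft I = s i by rewrite /bleft bE.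
have rE : bright I = (s j.+2)%:E by rewrite /bright bE.
rewrite rankG_mrk lE; apply: hrank_gpts => //; last by rewrite -lE mrk_end_ge.
rewrite /mrk_end rE; have [j1S|] := ltnP j.+1 (size S); last first.
  rewrite leq_eqVlt => /orP[/eqP jE|]; last by rewrite ltnS leqNgt jS.
  rewrite -jE (gpts_last c : s _ = _) (negbTE (clast_notin gS c)).
  have -> : j = (size S).-1 by rewrite jE.
  by apply: (in_cell_ge gS); exact/ltW/clast_gt.
have [|d0 _ dl] := deltaP (c := c) (I := I) (i := j.+2) _ rE; first by [].
rewrite sE // mem_nth //; apply/andP; split.
  by rewrite -sE // -sE.
by rewrite (nth_map 0) // lte_fin gtrBl.
Qed.

Lemma rankG_mrk_inf i : (i <= size S)%N ->
  rankG yz (to_groth (mrk c cM (bar_of (s i) +oo%E))) = hrank (s i) (nth 0 S (size S).-1).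
Proof.
move=> iS; set I := bar_of _ _.
have bE : bends I = (s i, +oo%E) by apply: bends_bar_of; exact: ltry.
have lE : bleft I = s i by rewrite /bleft bE.
have rE : bright I = +oo%E by rewrite /bright bE.
rewrite rankG_mrk lE; apply: hrank_gpts; rewrite ?prednK ?(grid_size gS) //; last first.
  by rewrite -lE mrk_end_ge.
apply: (in_cell_ge gS); rewrite /mrk_end rE le_max -/s; apply/orP; right.
by rewrite -[X in s X](prednK (grid_size gS)) sE ?nth_last // prednK ?(grid_size gS).
Qed.

(** The sum of the values of [rankG] on the meta-diagram at all the intervals that
    start at the entry i of S and end after the cell j, for i <= j. The value 0 for j = size S is the empty contribution, and makes the
    formula of [rankG_mdgm] the same for bounded and unbounded intervals. *)
Definition gdiff (i j : nat) : int :=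
  if (j < size S)%N then hrank (s i.+1) (nth 0 S j) - hrank (s i) (nth 0 S j) else 0.

Lemma rankG_mdgm i j : (i <= j)%N -> (j < size S)%N ->
  rankG yz (mdgm c cM (gbar S i j.+1)) = gdiff i j - gdiff i j.+1.
Proof.
move=> ij jS; have iS := leq_ltn_trans ij jS.
have uS := grid_uniq gS.
have bE : bends (gbar S i j.+1) = (nth 0 S i, nth +oo%E (map EFin S) j.+1).
  exact: bends_gbar.
rewrite /mdgm /bleft /bright bE /= mem_nth //= index_uniq // -/s.
rewrite /gdiff jS; have [j1S|] := ltnP j.+1 (size S).
  rewrite (nth_map 0) // mem_nth //= index_uniq //.
  rewrite rankGB rankGD rankGB !rankG_mrk_fin //; try lia.
  by rewrite opprB -[LHS]addrA addrACA [RHS]addrACA; congr (_ + _); exact: addrC.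
rewrite leq_eqVlt => /orP[/eqP jE|]; last by rewrite ltnS leqNgt jS.
rewrite nth_default ?size_map -?jE // rankGB !rankG_mrk_inf //; last exact: ltnW.
by rewrite jE /= subr0.
Qed.

(** With p and q the cells of a and b, the grid intervals spanning a and b are those
    that start at an index i <= p and end at an index j > q. Summing over j leaves
    [gdiff i q], and summing that over i leaves the rank from s_(p+1) to s_(q+1) at
    the heights y and z, minus the one from s_0, which is 0. If a lies to the left of
    the grid, both sides are 0. *)
Lemma sum_rankG_mdgm (a b : R) : a <= b ->
  \sum_(I <- gbars S) (if spans a b I then rankG yz (mdgm c cM I) else 0) = hrank a b.
Proof.
move=> ab; have [sS _] := andP gS; rewrite /gbars big_allpairs_dep; apply/esym.
have inbE i j : (i < j)%N -> (i < size S)%N ->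
    spans a b (gbar S i j) = (nth 0 S i <= a) && (b%:E < nth +oo%E (map EFin S) j)%E.
  move=> ij iS; have bE := bends_gbar gS ij iS.
  apply/andP/andP => [[/set_mem[+ _] /set_mem[_ +]]|[ia bj]]; rewrite /bleft /bright ?bE //.
  split; apply/mem_set; split; rewrite /bleft /bright ?bE //=; last exact: le_trans ab.
  by apply: le_lt_trans bj; rewrite lee_fin.
have [aS|[p pS /(_ a (fun _ _ => erefl)) cp]] := in_cell_dec a gS.
  rewrite hrank_outside // big_seq big1 // => i; rewrite mem_iota add0n => /andP[_ iS].
  rewrite big_seq big1 // => j; rewrite mem_iota => /andP[ij _]; rewrite inbE //.
  rewrite leNgt (lt_le_trans aS) //; exact: sorted_nth_le.
have [bS|[q qS /(_ b (fun _ _ => erefl)) cq]] := in_cell_dec b gS.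
  case/andP: cp => + _; rewrite leNgt (le_lt_trans ab) // (lt_le_trans bS) //.
  exact: sorted_nth_le.
have uS : uniq S by move: sS; rewrite lt_sorted_uniq_le => /andP[].
have ltaE i : (i < size S)%N -> (nth 0 S i <= a) = (i <= p)%N.
  by move=> iS; rewrite (in_cell_le sS pS cp) ?mem_nth // index_uniq.
have ltbE j : (j <= size S)%N -> (b%:E < nth +oo%E (map EFin S) j)%E = (q < j)%N.
  rewrite leq_eqVlt => /orP[/eqP ->|jS]; first by rewrite nth_default ?size_map // ltry qS.
  rewrite (nth_map 0) // lte_fin ltNge (in_cell_le sS qS cq) ?mem_nth //.
  by rewrite index_uniq // -ltnNge.
have pq : (p <= q)%N.
  rewrite -(index_uniq 0 pS uS) -(in_cell_le sS qS cq) ?mem_nth //.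
  by apply: le_trans ab; case/andP: cp.
pose Q i := hrank (s i) (nth 0 S q).
transitivity (\sum_(0 <= i < size S) (if (i <= p)%N then Q i.+1 - Q i else 0)); last first.
  rewrite /index_iota subn0; apply: eq_big_seq => i; rewrite mem_iota add0n => /andP[_ iS].
  have -> : iota i.+1 (size S - i) = index_iota i.+1 (size S).+1 by rewrite /index_iota subSS.
  transitivity (\sum_(i.+1 <= j < (size S).+1) if (q < j)%N then
      if (i <= p)%N then gdiff i j.-1 - gdiff i j else 0 else 0); last first.
    apply: eq_big_seq => j; rewrite mem_index_iota => /andP[ij jS].
    rewrite inbE // ltaE // ltbE // andbC; case: ifP => //= _; case: ifP => // _.
    have j0 : (0 < j)%N by exact: leq_ltn_trans ij.
    by rewrite -{3}(prednK j0) rankG_mdgm ?prednK //; lia.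
  case: leqP => [ip|_]; last by rewrite big1 // => j _; rewrite if_same.
  rewrite sum_above ?(leq_trans ip) //=.
  under eq_bigr do rewrite -opprB.
  rewrite sumrN telescope_sumr; last exact: ltnW.
  by rewrite opprB /gdiff ltnn qS subr0.
rewrite (big_cat_nat (n := p.+1)) //= [X in _ + X]big_nat [X in _ + X]big1 ?addr0; last first.
  by move=> i /andP[pi _]; rewrite leqNgt pi.
rewrite big_nat; under eq_bigr => i /andP[_ ip] do rewrite -ltnS ip.
rewrite -big_nat telescope_sumr // /Q (hrank_outside _ (cfirst_lt c)) subr0.
rewrite sE //; apply: (hrank_cell pS qS) => //; try exact: in_cell_nth.
exact: sorted_nth_le.
Qed.

End MetaRank.

(** * Counting rectangles *)

Lemma count_rects (R : realType) (L : seq (bar R)) (B : bar R -> {mset bar R}%mset)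
    (a1 a2 b1 b2 : R) :
  uniq L -> (forall I, I \notin L -> B I = mset0) ->
  (count (fun Q : pintv (R *p R) => ((a1, a2) \in pset Q) && ((b1, b2) \in pset Q))
    (\big[@msetD _/mset0]_(I \in [set: bar R]) seq_mset [seq rect I J | J <- B I])%classic)%:Z
  = \sum_(I <- L) (if spans a1 b1 I then (count (spans a2 b2) (B I))%:Z else 0).
Proof.
move=> uL B0; rewrite (count_fsbig_mset _ uL) => [|I /B0 ->]; last first.
  by apply/msetP => x; rewrite mset_seqE enum_mset0 mset0E.
rewrite (big_morph Posz PoszD erefl); apply: eq_bigr => I _.
have /permP -> := perm_eq_seq_mset [seq rect I J | J <- B I].
have rectE x y J :
    ((x, y) \in pset (rect I J)) = (x \in pset (bar_itv I)) && (y \in pset (bar_itv J)).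
  apply/idP/andP => [/set_mem[/= ? ?]|[/set_mem ? /set_mem ?]]; last exact/mem_set.
  by split; apply/mem_set.
rewrite count_map (eq_count (a2 := fun J => spans a1 b1 I && spans a2 b2 J)) => [|J].
  by case: (spans a1 b1 I) => //; rewrite (eq_count (a2 := pred0)) ?count_pred0.
by rewrite /= !rectE andbACA.
Qed.

Theorem proposition27 (k : fieldType) (R : realType) (M : pmod k (R *p R)%type)
    (S : seq R) (cM : S_constructible2 S M) (c : choices S) :
  rank_decomposition M (pos_rects c cM) (neg_rects c cM).
Proof.
move=> [a1 a2] [b1 b2] h; have := h; rewrite leEprod /= => /andP[ab1 ab2].
have uL := uniq_gbars (grid_constructible cM).
have [pos0 neg0] := signed_barcode0 k R.
rewrite !rank_inv_kints (count_rects _ _ _ _ uL) => [|I IL]; last by rewrite mdgm_off_grid.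
rewrite (count_rects _ _ _ _ uL) => [|I IL]; last by rewrite mdgm_off_grid.
rewrite -sumrB -hrankE -(sum_rankG_mdgm cM ab2 c ab1).
by apply: eq_bigr => I _; case: (spans a1 b1 I); rewrite ?subr0 // rankG_bars.
Qed.
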